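(* Let $D=\{s\in\mathbb{C}:\operatorname{Re}(s)>0\}$ and let $\zeta_+^{(t)}$ be the renormalised multiple zeta values at negative integers defined in the context. a) If $t\in D\cap\mathbb{Q}$, then $\zeta_+^{(t)}(\mathbf{k})\in\mathbb{Q}$ for every $n\in\mathbb{N}$ and every $\mathbf{k}\in(\mathbb{Z}_{<0})^n$. b) If $t\in D\cap\mathbb{R}$ is transcendental over $\mathbb{Q}$, then there exist $n\in\mathbb{N}$ and $\mathbf{k}\in(\mathbb{Z}_{<0})^n$ such that $\zeta_+^{(t)}(\mathbf{k})\in\mathbb{R}\setminus\mathbb{Q}$.
   Context: Here $\mathbb{N}=\{1,2,\ldots\}$. Let $Y^-=\{y_n:n\in\mathbb{Z}_{<0}\}$ and let $\mathfrak{h}^-=\mathbb{Q}\langle Y^-\rangle$ be the $\mathbb{Q}$-span of all words in $Y^-$ with empty word $\mathbf{1}$. Regularisation: for $t\in D$, $0<q<1$ and $k_1,\ldots,k_n\in\mathbb{N}$ put $$\overline{\zeta}_q^{(t)}(y_{-k_1}\cdots y_{-k_n})=\sum_{m_1>\cdots>m_n>0}\ \prod_{j=1}^n q^{k_jm_jt}(1-q^{m_j})^{k_j}$$ (a convergent series; $q^{a}=e^{a\log q}$). Substituting $q=e^z$ (real $z<0$) gives a function of $z$ which extends meromorphically to a neighbourhood of $z=0$, and $\overline{\zeta}_{e^z}^{(t)}$ denotes its Laurent expansion at $z=0$. Let $\mathbb{C}[z^{-1},z]]$ be the algebra of formal Laurent series with finitely many negative powers. Define the $\mathbb{Q}$-linear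 map $\psi^{(t)}:\mathfrak{h}^-\to\mathbb{C}[z^{-1},z]]$ by $\psi^{(t)}(\mathbf{1})=1$ and $$\psi^{(t)}(y_{-k_1}\cdots y_{-k_n})(z)=\frac{(-1)^{k_1+\cdots+k_n}}{z^{k_1+\cdots+k_n}}\,\overline{\zeta}_{e^z}^{(t)}(y_{-k_1}\cdots y_{-k_n}).$$ Renormalisation (Birkhoff decomposition with minimal subtraction, for the deconcatenation coproduct): let $\pi$ be the projection $\pi(\sum_{n\ge -k}a_nz^n)=\sum_{n=-k}^{-1}a_nz^n$ on $\mathbb{C}[z^{-1},z]]$. The linear maps $\psi^{(t)}_\pm$ on $\mathfrak{h}^-$ are defined by $\psi_\pm^{(t)}(\mathbf{1})=1$ and, recursively on the length of a word $w=y_{-k_1}\cdots y_{-k_n}$, $n\ge1$, $$\psi_-^{(t)}(w)=-\pi(R(w)),\qquad \psi_+^{(t)}(w)=(\mathrm{Id}-\pi)(R(w)),$$ $$R(w)=\psi^{(t)}(w)+\sum_{j=1}^{n-1}\psi_-^{(t)}(y_{-k_1}\cdots y_{-k_j})\,\psi^{(t)}(y_{-k_{j+1}}\cdots y_{-k_n}).$$ Thus $\psi_+^{(t)}(w)\in\mathbb{C}[[z]]$. The renormalised multiple zeta values are $$\zeta_+^{(t)}(-k_1,\ldots,-k_n)=\lim_{z\to0}\psi_+^{(t)}(y_{-k_1}\cdots y_{-k_n})(z),$$ i.e. the constant term of $\psi_+^{(t)}(y_{-k_1}\cdots y_{-k_n})$. *)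

(* Defs.v *)
From HB Require Import structures.
From mathcomp Require Import all_boot all_order all_algebra.
From mathcomp Require Import all_classical all_reals all_analysis.
From mathcomp Require Import complex.
Set Implicit Arguments.
Unset Strict Implicit.
Unset Printing Implicit Defensive.
Import Order.TTheory GRing.Theory Num.Theory.
Import numFieldNormedType.Exports.
Local Open Scope classical_set_scope.
Local Open Scope complex_scope.
Local Open Scope ring_scope.

Section Defs.
Variable R : realType.
Local Notation C := R[i].

(* A word over the alphabet {y_n | n in Z, n < 0} is the list of its indices:
   y_{-k_1} ... y_{-k_n} is [:: - k_1; ...; - k_n], so that k_j is `|n_j|%N.
   The linear maps of the construction are given by their values on words. *)
Definition word := seq int.

Definition is_word (w : word) : bool := all (fun k : int => k < 0) w.

Definition weight (w : word) : nat := (\sum_(k <- w) `|k|)%N.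

Definition cexp (z : C) : C :=
  (expR (complex.Re z))%:C * (cos (complex.Im z) +i* sin (complex.Im z)).

Definition qpow (q : R) (a : C) : C := cexp (a * (ln q)%:C).

(* m is read as m_1, ..., m_n; the terms range over N >= m_1 > ... > m_n > 0. *)
Definition qzeta_partial (t : C) (q : R) (w : word) (N : nat) : C :=
  \sum_(m : (size w).-tuple 'I_N.+1 |
        sorted (fun i j : 'I_N.+1 => j < i)%N m
        && all (fun i : 'I_N.+1 => 0 < i)%N m)
    \prod_(j < size w)
      (qpow q (`|w`_j|%:R * (tnth m j)%:R * t)
       * (1 - (q ^+ tnth m j)%:C) ^+ `|w`_j|).

(* R[i]^o is R[i] with the topology of its norm. *)
Definition qzeta (t : C) (q : R) (w : word) : C :=
  lim ((qzeta_partial t q w : nat -> R[i]^o) @ \oo).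

(* A formal Laurent series is its coefficient function; the functions that
   occur below vanish at all sufficiently negative indices. *)
Definition laurent := int -> C.

(* f, given on negative reals, extends to a function F that is meromorphic
   around 0 with Laurent expansion a. *)
Definition is_laurent_expansion (f : R -> C) (a : laurent) : Prop :=
  exists (N : nat) (delta : R) (F : C -> C),
    [/\ 0 < delta,
        forall n : int, n < - N%:Z -> a n = 0,
        forall z : C, z != 0 -> `|z| < delta%:C ->
          (fun M : nat => \sum_(i < M) a (i%:Z - N%:Z) * z ^ (i%:Z - N%:Z)
             : R[i]^o) @ \oo --> (F z : R[i]^o)
      & forall x : R, - delta < x -> x < 0 -> F x%:C = f x].

(* The zero series is the default value when there is no expansion. *)
Definition laurent_expansion (f : R -> C) : laurent :=
  xget (fun=> 0) [set a | is_laurent_expansion f a].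

Definition lone : laurent := fun n => (n == 0)%:R.

(* The sum has finite support when f and g vanish at sufficiently negative
   indices. *)
Definition lmul (f g : laurent) : laurent :=
  fun n => \sum_(i \in [set: int]) f i * g (n - i).

Definition lproj (f : laurent) : laurent := fun n => if n < 0 then f n else 0.

Definition psi (t : C) (w : word) : laurent :=
  if w is [::] then lone else
  fun n => (-1) ^+ weight w
           * laurent_expansion (fun x => qzeta t (expR x) w) (n + (weight w)%:Z).

(* The recursion on the length of w is bounded by a fuel l >= size w; see
   psi_minusE below. *)
Fixpoint psi_minus_rec (t : C) (l : nat) (w : word) : laurent :=
  match l, w with
  | l'.+1, _ :: _ => fun n =>
      - lproj (fun i => psi t w i +
          \sum_(1 <= j < size w)
             lmul (psi_minus_rec t l' (take j w)) (psi t (drop j w)) i) n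
  | _, _ => lone
  end.

Definition psi_minus (t : C) (w : word) : laurent :=
  psi_minus_rec t (size w) w.

Definition bogoliubov (t : C) (w : word) : laurent :=
  fun n => psi t w n +
    \sum_(1 <= j < size w) lmul (psi_minus t (take j w)) (psi t (drop j w)) n.

Definition psi_plus (t : C) (w : word) : laurent :=
  if w is [::] then lone else
  fun n => bogoliubov t w n - lproj (bogoliubov t w) n.

Lemma psi_minus_recE (t : C) (l : nat) (w : word) : (size w <= l)%N ->
  psi_minus_rec t l w = psi_minus t w.
Proof.
elim: l {-2}l (leqnn l) w => [|b IHb] l.
  by rewrite leqn0 => /eqP -> [].
case: l => [_ []//|l]; rewrite ltnS => lb [//|x w] wl.
rewrite /psi_minus [size _]/=.
apply/funext => n; rewrite [LHS]/= [RHS]/=; congr (- _).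
rewrite /lproj; case: ifP => // _; congr (_ + _).
rewrite !big_nat; apply: eq_bigr => j /andP[j0 jw]; congr (lmul _ _ _).
have sj : (size (take j (x :: w)) <= size w)%N by rewrite size_take /= jw -ltnS.
have wl' : (size w <= l)%N by [].
by rewrite !IHb // ?(leq_trans sj) // (leq_trans wl').
Qed.

Lemma psi_minus_nil (t : C) : psi_minus t [::] = lone.
Proof. by []. Qed.

Lemma psi_minusE (t : C) (w : word) : w != [::] ->
  psi_minus t w = fun n => - lproj (bogoliubov t w) n.
Proof.
case: w => [//|x w] _; apply/funext => n.
rewrite {1}/psi_minus [size _]/= [LHS]/=; congr (- _).
rewrite /lproj; case: ifP => // _; congr (_ + _).
rewrite !big_nat; apply: eq_bigr => j /andP[j0 jw]; congr (lmul _ _ _).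
by rewrite psi_minus_recE // size_take /= jw -ltnS.
Qed.

(* The constant term of psi_plus. *)
Definition zeta_plus (t : C) (k : word) : C := psi_plus t k 0.

Definition in_D (t : C) : Prop := 0 < complex.Re t.

Definition crational (z : C) : Prop := exists r : rat, z = ratr r.

Definition transcendental (z : C) : Prop :=
  ~ algebraicOver (ratr : rat -> C) z.

End Defs.

(* Main.v *)
(* Expanding the factors [(1 - q^m)^k] and summing geometric progressions, the
   q-zeta value of a word at [q = e^x] is a rational combination of products of
   [e^(A x) / (1 - e^(A x))], where [A = K t + I] with natural numbers [K > 0]
   and [I]. Each of these functions has the Laurent expansion
   [sum_n b_n A^(n - 1) x^(n - 1)] with rational [b_n] (Bernoulli numbers), so
   all coefficients of [psi t w] lie in every field containing [t]; the
   recursion for [psi_plus] only uses ring operations, which gives a).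

   For b), [zeta_plus t (-1, -3)] is a rational function of [t] over the
   rationals, and the only contributions to its polar part at [t = -1/4] come
   from the term [b_0 b_6 A^5 / B] with [B = 4 t + 1], which occurs for [A = t]
   with weight [-3] and for [A = t + 1] with weight [-1]. As
   [3 t^5 + (t + 1)^5 = 15 / 64] at [t = -1/4] and [b_6 <> 0], this function is
   not constant, so its value at a transcendental [t] is irrational. *)
Require Import Defs.
From mathcomp Require Import all_boot all_order all_algebra.
From mathcomp Require Import all_classical all_reals all_analysis.
From mathcomp Require Import complex zify ring lra.
Import Order.TTheory GRing.Theory Num.Theory.
Import numFieldNormedType.Exports.
Local Open Scope ring_scope.

Set Implicit Arguments.
Unset Strict Implicit.
Unset Printing Implicit Defensive.

(** * Expansions at 0 from the left *)

Section TaylorExpansion.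
Variable R : realType.
Implicit Types (f g : R -> R) (a b : nat -> R).

(* The error bound holds with the same constants for all orders [n], so that
   the expansion converges; only the negative side of 0 is considered. *)
Definition taylor f a : Prop :=
  exists M rho : R, [/\ 0 <= M, 1 <= rho &
    forall x n, x < 0 -> rho * `|x| <= 1 ->
      `|f x - \sum_(i < n) a i * x ^+ i| <= M * (rho * `|x|) ^+ n].

Definition conv (K : pzSemiRingType) (a b : nat -> K) (n : nat) : K :=
  \sum_(i < n.+1) a i * b (n - i)%N.

Lemma taylor_eq f g a b : (forall x, x < 0 -> f x = g x) -> a =1 b ->
  taylor f a -> taylor g b.
Proof.
move=> fg ab [M [rho [M0 rho1 H]]]; exists M, rho; split=> // x n x0 xr.
rewrite -fg//; under eq_bigr do rewrite -ab; exact: H.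
Qed.

(** Enlarging [rho] shrinks the range of [x] and weakens the bound, so the constants of two
    expansions can be merged by adding them. *)
Lemma taylor_widen f a (M rho M' rho' : R) : 0 <= M -> 1 <= rho ->
  M <= M' -> rho <= rho' ->
  (forall x n, x < 0 -> rho * `|x| <= 1 ->
      `|f x - \sum_(i < n) a i * x ^+ i| <= M * (rho * `|x|) ^+ n) ->
  forall x n, x < 0 -> rho' * `|x| <= 1 ->
      `|f x - \sum_(i < n) a i * x ^+ i| <= M' * (rho' * `|x|) ^+ n.
Proof.
move=> M0 r1 MM rr H x n x0 xr.
have r0 : 0 <= rho by apply: le_trans r1.
have le1 : rho * `|x| <= rho' * `|x| by rewrite ler_wpM2r.
apply: (le_trans (H x n x0 (le_trans le1 xr))).
apply: ler_pM => //; first by rewrite exprn_ge0 ?mulr_ge0.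
by rewrite lerXn2r ?nnegrE ?mulr_ge0 // (le_trans r0).
Qed.

Lemma taylor_common f a g b : taylor f a -> taylor g b ->
  exists M rho : R, [/\ 0 <= M, 1 <= rho,
    forall x n, x < 0 -> rho * `|x| <= 1 ->
      `|f x - \sum_(i < n) a i * x ^+ i| <= M * (rho * `|x|) ^+ n &
    forall x n, x < 0 -> rho * `|x| <= 1 ->
      `|g x - \sum_(i < n) b i * x ^+ i| <= M * (rho * `|x|) ^+ n].
Proof.
move=> [M [rho [M0 r1 H]]] [M' [rho' [M'0 r'1 H']]].
exists (M + M'), (rho + rho'); split.
- by rewrite addr_ge0.
- by rewrite (le_trans r1)// lerDl (le_trans ler01).
- by apply: (taylor_widen M0 r1 _ _ H); rewrite lerDl // (le_trans ler01).
- by apply: (taylor_widen M'0 r'1 _ _ H'); rewrite lerDr // (le_trans ler01).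
Qed.

Lemma taylor_cst (c : R) : taylor (fun=> c) (fun n => if n == 0%N then c else 0).
Proof.
exists `|c|, 1; split=> // x [|n] _ _.
  by rewrite big_ord0 subr0 expr0 mulr1.
rewrite big_ord_recl /= expr0 mulr1 big1 ?addr0 ?subrr ?normr0; last first.
  by move=> i _; rewrite mul0r.
by rewrite mulr_ge0// exprn_ge0// mulr_ge0.
Qed.

Lemma taylorD f a g b : taylor f a -> taylor g b ->
  taylor (fun x => f x + g x) (fun n => a n + b n).
Proof.
move=> fa gb; have [M [rho [M0 r1 H H']]] := taylor_common fa gb.
exists (M *+ 2), rho; split; rewrite ?mulrn_wge0// => x n x0 xr.
under eq_bigr do rewrite mulrDl; rewrite big_split /= opprD addrACA.
by rewrite (le_trans (ler_normD _ _))// mulrnAl mulr2n lerD ?H ?H'.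
Qed.

Lemma taylorZ (c : R) f a : taylor f a ->
  taylor (fun x => c * f x) (fun n => c * a n).
Proof.
move=> [M [rho [M0 r1 H]]]; exists (`|c| * M), rho; split=> //.
  by rewrite mulr_ge0.
move=> x n x0 xr; under eq_bigr do rewrite -mulrA.
by rewrite -mulr_sumr -mulrBr normrM -mulrA ler_wpM2l// H.
Qed.

Lemma taylor_sum (I : eqType) (s : seq I) (f : I -> R -> R) (a : I -> nat -> R) :
  (forall i, i \in s -> taylor (f i) (a i)) ->
  taylor (fun x => \sum_(i <- s) f i x) (fun n => \sum_(i <- s) a i n).
Proof.
elim: s => [|i s IH] H.
  apply: taylor_eq (taylor_cst 0) => [x _|n]; rewrite big_nil//.
  by case: ifP.
have Hs : forall j, j \in s -> taylor (f j) (a j).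
  by move=> j js; apply: H; rewrite inE js orbT.
have := taylorD (H i (mem_head _ _)) (IH Hs).
by apply: taylor_eq => [x _|n]; rewrite big_cons.
Qed.

(** The term of index [n] is the difference of the errors of orders [n] and [n.+1]. *)
Lemma taylor_coef_bound f a (M rho : R) : 0 <= M ->
  (forall x n, x < 0 -> rho * `|x| <= 1 ->
      `|f x - \sum_(i < n) a i * x ^+ i| <= M * (rho * `|x|) ^+ n) ->
  0 <= rho ->
  forall x n, x < 0 -> rho * `|x| <= 1 ->
    `|a n * x ^+ n| <= (2 * M) * (rho * `|x|) ^+ n.
Proof.
move=> M0 H r0 x n x0 xr.
have := H x n.+1 x0 xr; rewrite big_ord_recr /= => H1.
have -> : a n * x ^+ n = (f x - \sum_(i < n) a i * x ^+ i)
   - (f x - (\sum_(i < n) a i * x ^+ i + a n * x ^+ n)) by ring.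
rewrite (le_trans (ler_normB _ _))// mulrDl mul1r mulrDl lerD ?H//.
apply: le_trans H1 _; rewrite ler_wpM2l// exprSr ler_piMr//.
by rewrite exprn_ge0// mulr_ge0.
Qed.

Lemma expr_split_ord (K : pzRingType) (x : K) n (i : 'I_n) :
  x ^+ n = x ^+ i * x ^+ (n - i).
Proof. by rewrite -exprD subnKC// ltnW. Qed.

(** Both sides add up [a i * b j * x ^+ (i + j)] over [i + j < n]. *)
Lemma conv_psum (K : comPzRingType) (a b : nat -> K) (x : K) n :
  \sum_(k < n) conv a b k * x ^+ k =
  \sum_(i < n) a i * x ^+ i * \sum_(j < n - i) b j * x ^+ j.
Proof.
elim: n => [|n IH]; first by rewrite !big_ord0.
rewrite big_ord_recr /= IH /conv [RHS]big_ord_recr /= big_ord_recr /=.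
rewrite subSnn big_ord1 expr0 mulr1 subnn.
under [in RHS]eq_bigr => i _ do
  rewrite subSn 1?ltnW// big_ord_recr /= mulrDr.
rewrite big_split /= -addrA; congr (_ + _).
rewrite mulrDl mulr_suml; congr (_ + _); last by ring.
apply: eq_bigr => i _; rewrite (expr_split_ord x i); ring.
Qed.

Lemma double1_le3X n : (1 + 2 * n%:R : R) <= 3 ^+ n.
Proof.
elim: n => [|n IH]; first by rewrite mulr0 addr0 expr0.
have h : (1 : R) <= 3 ^+ n by rewrite exprn_ege1// ler1n.
by rewrite exprS -natr1; lra.
Qed.

(* With [S_n] the partial sums, [f g - sum_(k < n) (a * b)_k x^k] equals
   [(f - S_n a) g + sum_(i < n) a_i x^i (g - S_(n - i) b)]. *)
Lemma taylorM f a g b : taylor f a -> taylor g b ->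
  taylor (fun x => f x * g x) (conv a b).
Proof.
move=> fa gb; have [M [rho [M0 r1 H H']]] := taylor_common fa gb.
have r0 : 0 <= rho by apply: le_trans r1.
exists (M * M), (3 * rho); split; first exact: mulr_ge0.
  by apply: (le_trans r1); rewrite ler_peMl// ler1n.
move=> x n x0 xr3.
have xr : rho * `|x| <= 1.
  by apply: le_trans xr3; rewrite ler_wpM2r// ler_peMl// ler1n.
have y0 : 0 <= rho * `|x| by rewrite mulr_ge0.
rewrite conv_psum.
set Sa := \sum_(i < n) a i * x ^+ i.
have -> : f x * g x - \sum_(i < n) a i * x ^+ i * (\sum_(j < n - i) b j * x ^+ j)
  = (f x - Sa) * g x +
    \sum_(i < n) a i * x ^+ i * (g x - \sum_(j < n - i) b j * x ^+ j).
  rewrite mulrBl -addrA; congr (_ + _); rewrite /Sa mulr_suml -sumrN -sumrN.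
  by rewrite -big_split /=; apply: eq_bigr => i _; ring.
(* The summand 1 accounts for [(f x - Sa) * g x], with [g] bounded by its error of order 0; each of
   the [n] other terms costs at most 2, by [taylor_coef_bound]. Tripling [rho] then absorbs the
   number of terms. *)
apply: (@le_trans _ _ (M * M * (rho * `|x|) ^+ n * (1 + 2 * n%:R))); last first.
  rewrite -(mulrA 3) (exprMn n 3) [leRHS]mulrA [leRHS]mulrAC.
  by rewrite ler_wpM2l ?double1_le3X// !mulr_ge0// exprn_ge0.
rewrite mulrDr mulr1 (le_trans (ler_normD _ _))// lerD//.
  rewrite normrM mulrAC ler_pM ?H//.
  by have := H' x 0%N x0 xr; rewrite big_ord0 subr0 expr0 mulr1.
apply: (le_trans (ler_norm_sum _ _ _)).
apply: (@le_trans _ _ (\sum_(i < n) 2 * M * M * (rho * `|x|) ^+ n)); last first.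
  by rewrite sumr_const card_ord -[leLHS]mulr_natr le_eqVlt; apply/orP; left;
    apply/eqP; ring.
apply: ler_sum => i _; rewrite normrM.
rewrite (expr_split_ord _ i).
have -> y z : 2 * M * M * (y * z) = (2 * M * y) * (M * z) :> R by ring.
by rewrite ler_pM ?H' ?(taylor_coef_bound M0 H r0).
Qed.

Lemma taylor_scale f a (A : R) : 0 < A -> taylor f a ->
  taylor (fun x => f (A * x)) (fun n => a n * A ^+ n).
Proof.
move=> A0 [M [rho [M0 r1 H]]]; have r0 : 0 <= rho by apply: le_trans r1.
(* The factor [A + 1] instead of [A] keeps the constant at least 1 for small [A]. *)
exists M, (rho * (A + 1)); split => //.
  by rewrite -[leLHS]mulr1 ler_pM// lerDr ltW.
move=> x n x0 xr.
have le1 : rho * `|A * x| <= rho * (A + 1) * `|x|.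
  by rewrite normrM (gtr0_norm A0) -mulrA ler_wpM2l// ler_wpM2r// lerDl.
have := H (A * x) n; rewrite nmulr_llt0// => /(_ A0 (le_trans le1 xr)).
under eq_bigr do rewrite exprMn mulrA.
move=> /le_trans; apply; rewrite ler_wpM2l// lerXn2r// nnegrE mulr_ge0//.
by rewrite mulr_ge0// addr_ge0// ltW.
Qed.

Lemma natr_le2X n : (n%:R : R) <= 2 ^+ n.
Proof. by rewrite -natrX ler_nat ltnW// ltn_expl. Qed.

(** For the partial sum [S] of [b], the product [h * (h^-1 - S)] is minus the sum of the
    [b i * x ^+ i] times errors of [h], and dividing by [h] does not increase norms. Of the factor 4
    in the new [rho], one 2 pays for the growth of [b], the other for the number of terms. *)
Lemma taylorV h a b : (forall x, x < 0 -> 1 <= `|h x|) -> taylor h a ->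
  (forall n, conv b a n = (n == 0%N)%:R) -> (forall n, `|b n| <= 2 ^+ n) ->
  taylor (fun x => (h x)^-1) b.
Proof.
move=> h1 [M [rho [M0 r1 H]]] ba b2.
have r0 : 0 <= rho by apply: le_trans r1.
exists (M + 1), (4 * rho); split; first exact: addr_ge0.
  by apply: (le_trans r1); rewrite ler_peMl// ler1n.
move=> x n x0 xr4.
have xr : rho * `|x| <= 1.
  by apply: le_trans xr4; rewrite ler_wpM2r// ler_peMl// ler1n.
have hn0 : h x != 0 by rewrite -normr_gt0 (lt_le_trans ltr01)// h1.
case: n => [|n].
  rewrite big_ord0 subr0 expr0 mulr1 normfV (@le_trans _ _ 1)//.
    by rewrite invf_le1 ?h1// normr_gt0.
  by rewrite lerDr.
set S := \sum_(i < _) _.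
apply: (@le_trans _ _ `|h x * ((h x)^-1 - S)|).
  by rewrite normrM ler_peMl// h1.
have one : \sum_(k < n.+1) conv b a k * x ^+ k = 1.
  rewrite big_ord_recl ba expr0 mulr1 big1 ?addr0// => i _.
  by rewrite ba mul0r.
have -> : h x * ((h x)^-1 - S) =
   - \sum_(i < n.+1) b i * x ^+ i * (h x - \sum_(j < n.+1 - i) a j * x ^+ j).
  under eq_bigr do rewrite mulrBr.
  by rewrite sumrB -conv_psum one mulrBr divff// opprB -mulr_suml mulrC [S * _]mulrC.
rewrite normrN (le_trans (ler_norm_sum _ _ _))//.
apply: (@le_trans _ _ (\sum_(i < n.+1) M * (2 * rho * `|x|) ^+ n.+1)); last first.
  rewrite sumr_const card_ord -[leLHS]mulr_natr.
  have -> : 4 * rho * `|x| = 2 * rho * `|x| * 2 by ring.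
  rewrite (exprMn _ _ 2) mulrA ler_pM ?natr_le2X//.
    by rewrite mulr_ge0// exprn_ge0// !mulr_ge0.
  by rewrite ler_wpM2r ?lerDl// exprn_ge0// !mulr_ge0.
apply: ler_sum => i _; rewrite normrM.
rewrite (expr_split_ord _ i) mulrCA ler_pM//.
  rewrite normrM normrX -mulrA exprMn ler_pM// ?exprn_ge0//.
  by rewrite lerXn2r// ?nnegrE ?mulr_ge0// ler_peMl.
apply: le_trans (H x _ x0 xr) _.
rewrite ler_wpM2l// lerXn2r// ?nnegrE ?mulr_ge0//.
by rewrite ler_wpM2r// ler_peMl// ler1n.
Qed.

End TaylorExpansion.

(** * The expansion of x e^x / (1 - e^x) *)

(** Course-of-values recursion: the list keeps all earlier values, and each new one makes the next
    coefficient of the Cauchy product with [expm1_coef] vanish. *)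
Fixpoint bern_seq (n : nat) : seq rat :=
  if n is m.+1 then
    rcons (bern_seq m)
      (\sum_(i < n) (bern_seq m)`_i * ((-1) ^+ (n - i).+1 / (n - i).+1`!%:R))
  else [:: -1].

(* The Taylor coefficients of [x e^x / (1 - e^x)], that is minus the Bernoulli
   numbers divided by [n!], with the convention [B_1 = 1/2]. *)
Definition bern (n : nat) : rat := (bern_seq n)`_n.

(* The Taylor coefficients of [(e^(-x) - 1) / x]. *)
Definition expm1_coef (n : nat) : rat := (-1) ^+ n.+1 / n.+1`!%:R.

Lemma size_bern_seq n : size (bern_seq n) = n.+1.
Proof. by elim: n => //= n IH; rewrite size_rcons IH. Qed.

Lemma nth_bern_seq n i : (i <= n)%N -> (bern_seq n)`_i = bern i.
Proof.
elim: n => [|n IH]; first by rewrite leqn0 => /eqP ->.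
rewrite leq_eqVlt => /predU1P[->//|]; rewrite ltnS => lein.
by rewrite /= nth_rcons size_bern_seq ltnS lein IH.
Qed.

Lemma bernS n : bern n.+1 = \sum_(i < n.+1) bern i * expm1_coef (n.+1 - i).
Proof.
rewrite /bern /= nth_rcons size_bern_seq ltnn eqxx.
by apply: eq_bigr => i _; rewrite nth_bern_seq// -ltnS.
Qed.

Lemma bern0 : bern 0 = -1. Proof. exact: erefl. Qed.

Lemma conv_bern n : conv bern expm1_coef n = (n == 0%N)%:R.
Proof.
have e0 : expm1_coef 0 = -1 by [].
rewrite /conv; case: n => [|n]; first by rewrite big_ord1 e0 bern0 mulrNN mulr1.
by rewrite big_ord_recr /= -bernS subnn e0 mulrN1 subrr.
Qed.

Local Ltac expand_bern :=
  rewrite bernS !big_ord_recr big_ord0 /= /expm1_coef ?subSS ?subn0;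
  rewrite !factS fact0 !natrM /=.

(** The value is [- B_6 / 6!] with [B_6 = 1 / 42]; it is a factor of the polar part at
    [t = -1/4]. *)
Lemma bern6_neq0 : bern 6 != 0.
Proof.
have b1 : bern 1 = - (1 / 2) by expand_bern; rewrite bern0; field.
have b2 : bern 2 = - (1 / 12) by expand_bern; rewrite bern0 b1; field.
have b3 : bern 3 = 0 by expand_bern; rewrite bern0 b1 b2; field.
have b4 : bern 4 = 1 / 720 by expand_bern; rewrite bern0 b1 b2 b3; field.
have b5 : bern 5 = 0 by expand_bern; rewrite bern0 b1 b2 b3 b4; field.
have b6 : 42 * bern 6 = - (1 / 720).
  by expand_bern; rewrite bern0 b1 b2 b3 b4 b5; field.
apply/eqP => b60; move: b6; rewrite b60 mulr0 => /eqP.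
by rewrite eq_sym oppr_eq0 mul1r invr_eq0 pnatr_eq0.
Qed.

Lemma expm1_coef_le1 n : `|expm1_coef n| <= 1.
Proof.
rewrite normrM normrX normrN1 expr1n mul1r normfV normr_nat.
by rewrite invf_le1 ?ltr0n ?fact_gt0// ler1n fact_gt0.
Qed.

Lemma bern_bound n : `|bern n| <= 2 ^+ n.
Proof.
(* The induction carries the sum along: as [expm1_coef] has norm at most 1, [bern n.+1] is bounded
   by the sum of the norms of its predecessors. *)
suff [] : `|bern n| <= 2 ^+ n /\ \sum_(i < n.+1) `|bern i| <= 2 ^+ n.+1 - 1 by [].
elim: n => [|n [_ IH]]; first by rewrite big_ord1 bern0.
have le : `|bern n.+1| <= 2 ^+ n.+1 - 1.
  apply: le_trans IH; rewrite bernS (le_trans (ler_norm_sum _ _ _))//.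
  by apply: ler_sum => i _; rewrite normrM ler_piMr// expm1_coef_le1.
split; first by rewrite (le_trans le)// lerBlDr lerDl.
rewrite big_ord_recr /= (le_trans (lerD IH le))// [in leRHS]exprS.
by lra.
Qed.

Section ExpExpansion.
Variable R : realType.

(** In the tail [(n + i)!] is at least [i!], so [y ^+ n] factors out and leaves at most the full
    series. *)
Lemma expR_taylor_remainder (y : R) n : 0 <= y ->
  `|expR y - \sum_(i < n) y ^+ i / i`!%:R| <= y ^+ n * expR y.
Proof.
move=> y0; set S := fun n => \sum_(i < n) y ^+ i / i`!%:R.
have ES : series (exp_coeff y) = S.
  by apply/funext => k; rewrite /series /= big_mkord.
have cS : cvgn S by rewrite -ES; exact: is_cvg_series_exp_coeff.
have eS : expR y = limn S by rewrite -ES.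
have term0 i : 0 <= y ^+ i / i`!%:R by rewrite divr_ge0// exprn_ge0.
have ndS : {homo S : n m / (n <= m)%N >-> n <= m}.
  apply: homo_leq => //; first exact: le_trans.
  by move=> k; rewrite /S big_ord_recr /= lerDl.
have leS k : S k <= expR y by rewrite eS; exact: nondecreasing_cvgn_le.
rewrite -/(S n) ger0_norm ?subr_ge0// lerBlDl.
rewrite {1}eS; apply: limr_le => //.
apply: nearW => N /=.
apply: (@le_trans _ _ (S (n + N)%N)); first by apply: ndS; rewrite leq_addl.
rewrite /S big_split_ord /= lerD2l.
apply: (@le_trans _ _ (y ^+ n * S N)); last by rewrite ler_wpM2l ?exprn_ge0.
rewrite /S mulr_sumr; apply: ler_sum => i _; rewrite exprD -mulrA.
rewrite ler_wpM2l ?exprn_ge0// ler_wpM2l ?exprn_ge0//.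
rewrite lef_pV2 ?posrE ?ltr0n ?fact_gt0// ler_nat.
by rewrite -(@leq_pmul2r i`!) ?fact_gt0//; rewrite leq_pmul2r ?fact_gt0 // leq_fact // leq_addl.
Qed.

Lemma taylor_expm1 :
  taylor (fun x : R => (expR (- x) - 1) / x) (fun n => ratr (expm1_coef n)).
Proof.
(* With [rho = 1] only [-1 <= x < 0] matters, where [expR (- x)] is at most [expR 1]. *)
exists (expR 1), 1; split=> //.
move=> x n x0; rewrite !mul1r ltr0_norm// => xr.
set y := - x in xr *; have y0 : 0 < y by rewrite oppr_gt0.
have -> : x = - y by rewrite opprK.
clearbody y.
(* Order [n.+1], since the division by [x] lowers the order by one. *)
have := @expR_taylor_remainder y n.+1 (ltW y0).
rewrite big_ord_recl expr0 /= fact0 divr1 opprD addrA.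
set T := \sum_(i < n) _.
have -> : \sum_(i < n) ratr (expm1_coef i) * (- y) ^+ i = - (T / y).
  rewrite /T mulr_suml -sumrN; apply: eq_bigr => i _.
  rewrite /expm1_coef !(rmorphM, rmorphXn, rmorphN1, fmorphV, rmorph_nat) /bump /=.
  have sq : (-1) ^+ i * (-1) ^+ i = 1 :> R by rewrite -expr2 sqrr_sign.
  have y1 : y / y = 1 by rewrite divff// gt_eqF.
  rewrite [(- y) ^+ i]exprNn exprS add1n [y ^+ i.+1]exprS mulN1r !mulNr; congr (- _).
  transitivity ((-1) ^+ i * (-1) ^+ i * (y ^+ i / i.+1`!%:R)); first by ring.
  rewrite sq mul1r. transitivity (y / y * (y ^+ i / i.+1`!%:R)); last by ring.
  by rewrite y1 mul1r.
move=> h; rewrite invrN mulrN opprK addrC -mulNr -mulrDl normrM normfV.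
rewrite distrC (gtr0_norm y0) ler_pdivrMr//.
rewrite -mulrA -exprSr; apply: le_trans h _.
by rewrite mulrC ler_wpM2r ?ler_expR// exprn_ge0// ltW.
Qed.

(** This lower bound, required by [taylorV], is [1 + y <= expR y] at [y = - x]; it would fail for
    positive [x]. *)
Lemma expm1_ge1 (x : R) : x < 0 -> 1 <= `|(expR (- x) - 1) / x|.
Proof.
move=> x0; rewrite normrM normfV (ltr0_norm x0).
rewrite ler_pdivlMr ?oppr_gt0// mul1r.
rewrite (le_trans _ (ler_norm _))// lerBrDl.
exact: expR_ge1Dx.
Qed.

(** The function is the reciprocal of [(expR (- x) - 1) / x], and [bern] is the convolution inverse
    of [expm1_coef]. *)
Lemma taylor_bern :
  taylor (fun x : R => x * (expR x / (1 - expR x))) (fun n => ratr (bern n)).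
Proof.
have : taylor (fun x : R => ((expR (- x) - 1) / x)^-1) (fun n => ratr (bern n)).
  apply: (taylorV expm1_ge1 taylor_expm1) => n.
    have := congr1 (ratr : rat -> R) (conv_bern n).
    rewrite ratr_nat => <-; rewrite /conv rmorph_sum.
    by apply: eq_bigr => i _; rewrite rmorphM.
  have := bern_bound n; rewrite -(ler_rat R) rmorphXn rmorph_nat.
  by rewrite ratr_norm.
apply: taylor_eq => // x x0; rewrite expRN invf_div; congr (_ * _).
have e0 := expR_gt0 x.
have e1 : expR x < 1 by rewrite -expR0 ltr_expR.
by field; rewrite !gt_eqF ?subr_gt0//=.
Qed.

End ExpExpansion.

(** * Nested geometric sums *)

(* The sum over [N >= m_1 > ... > m_n > 0] of the products of the [f_j m_j]. *)
Fixpoint decsum (K : pzRingType) (s : seq (nat -> K)) (N : nat) : K :=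
  if s is f :: s' then \sum_(m < N) f m.+1 * decsum s' m else 1.

Lemma decsum_rmorph (K K' : pzRingType) (h : {rmorphism K -> K'})
    (s : seq (nat -> K)) N :
  h (decsum s N) = decsum [seq (fun m => h (f m)) | f <- s] N.
Proof.
elim: s N => [|f s IH] N /=; first by rewrite rmorph1.
by rewrite rmorph_sum; apply: eq_bigr => m _; rewrite rmorphM IH.
Qed.

(** The bound [M] varies in the induction while the index type ['I_N.+1] stays fixed; starting the
    path at [M.+1] encodes [m_1 <= M]. *)
Lemma decsum_tuple_path (K : comPzRingType) (s : seq (nat -> K)) N M : (M <= N)%N ->
  \sum_(m : (size s).-tuple 'I_N.+1 |
        path (fun i j => j < i)%N M.+1 (map val m)
        && all (fun i : 'I_N.+1 => 0 < i)%N m)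
    \prod_(j < size s) nth (fun=> 0) s j (tnth m j) = decsum s M.
Proof.
elim: s M => [|f s IH] M MN /=.
  under eq_bigr do rewrite big_ord0.
  rewrite (big_pred1 [tuple]) // => m.
  by rewrite (tuple0 m) /= eqxx.
pose cons2 (p : 'I_N.+1 * (size s).-tuple 'I_N.+1) := [tuple of p.1 :: p.2].
rewrite (reindex cons2) /=; last first.
  exists (fun t => (thead t, [tuple of behead t])) => [[a t] _|t _] /=.
    by rewrite /cons2 /=; congr (_, _); apply: val_inj.
  by rewrite /cons2 /= [RHS]tuple_eta.
(* Once the head [i] is chosen, the tail lies strictly below it, which gives the same kind of sum
   with bound [i.-1]. *)
transitivity (\sum_(i < N.+1 | (i < M.+1)%N && (0 < i)%N) f i * decsum s i.-1).
  have E (i : 'I_N.+1) : (i < M.+1)%N && (0 < i)%N ->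
      f i * decsum s i.-1 = \sum_(m : (size s).-tuple 'I_N.+1 |
        path (fun i j => j < i)%N i (map val m)
        && all (fun i : 'I_N.+1 => 0 < i)%N m)
      f i * \prod_(j < size s) nth (fun=> 0) s j (tnth m j).
    move=> /andP[iM i0]; rewrite -IH; last first.
      by rewrite -ltnS prednK// ltnW.
    by rewrite mulr_sumr prednK.
  rewrite (eq_bigr _ E) pair_big_dep /=; apply: eq_big => [[i m]|[i m] _] /=.
    by rewrite !andbA; congr (_ && _); rewrite -!andbA; congr (_ && _); rewrite andbC.
  by rewrite big_ord_recl /= tnth0; congr (_ * _); apply: eq_bigr => j _; rewrite tnthS.
rewrite (big_ord_widen _ (fun m => f m.+1 * decsum s m) MN).
rewrite big_mkcond big_ord_recl /= add0r [RHS]big_mkcond.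
by apply: eq_bigr => i _; rewrite /bump /= add1n ltnS andbT.
Qed.

Lemma decsum_tuple (K : comPzRingType) (s : seq (nat -> K)) n N : size s = n ->
  \sum_(m : n.-tuple 'I_N.+1 |
        sorted (fun i j : 'I_N.+1 => j < i)%N m
        && all (fun i : 'I_N.+1 => 0 < i)%N m)
    \prod_(j < n) nth (fun=> 0) s j (tnth m j) = decsum s N.
Proof.
move=> <-; rewrite -(@decsum_tuple_path _ _ N N)//; apply: eq_bigl => m.
congr (_ && _); case: m => -[|i m] _ //=.
by rewrite ltn_ord /= path_map.
Qed.

Section QSums.
Variable R : realType.

(** For [x * A < 0] this is the sum of [e^(x A m)] over all [m >= 1]. *)
Definition geom_ratio (x A : R) : R := expR (x * A) / (1 - expR (x * A)).

Definition exp_decsum (x : R) (s : seq R) : nat -> R :=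
  decsum [seq (fun m => expR (x * a) ^+ m) | a <- s].

(* Summing the geometric progression in [m_1] between [m_2 + 1] and [N]. *)
Lemma exp_decsum_cons2 (x a b : R) (s : seq R) N : expR (x * a) != 1 ->
  exp_decsum x (a :: b :: s) N = geom_ratio x a *
    (exp_decsum x (a + b :: s) N - expR (x * a) ^+ N * exp_decsum x (b :: s) N).
Proof.
move=> e1; have e1' : 1 - expR (x * a) != 0 by rewrite subr_eq0 eq_sym.
elim: N => [|N IH].
  by rewrite /exp_decsum /= !big_ord0 mulr0 subrr mulr0.
rewrite /exp_decsum /= big_ord_recr /=.
have -> : \sum_(i < N) expR (x * a) ^+ i.+1 *
    (\sum_(m < i) expR (x * b) ^+ m.+1 * exp_decsum x s m)
  = exp_decsum x (a :: b :: s) N by [].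
rewrite IH /exp_decsum /= !big_ord_recr /= -/(exp_decsum x s).
set S1 := \sum_(i < N) _; set S2 := \sum_(i < N) _.
rewrite /geom_ratio [x * (a + b)]mulrDr expRD exprMn -/(exp_decsum x s N) !exprS.
by field.
Qed.

Lemma cvg_expR_pow (x a : R) : x < 0 -> 0 < a ->
  ((fun N => expR (x * a) ^+ N) @ \oo --> (0 : R))%classic.
Proof.
move=> x0 a0; apply: cvg_expr.
by rewrite ger0_norm ?expR_ge0// -expR0 ltr_expR nmulr_rlt0.
Qed.

(** [c] collects the exponents already summed out: summing over the largest index adds its exponent
    to the next one, and the boundary term at [N] tends to 0. One ratio remains for each partial
    sum. *)
Lemma cvg_exp_decsum_cons (x c a : R) (s : seq R) : x < 0 -> 0 <= c ->
  all (> 0) (a :: s) ->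
  (exp_decsum x (c + a :: s) @ \oo -->
    \prod_(A <- scanl +%R c (a :: s)) geom_ratio x A)%classic.
Proof.
move=> x0; elim: s c a => [|b s IH] c a c0 /andP[a0 s0].
  have A0 : 0 < c + a by rewrite ltr_wpDl.
  have e1 : expR (x * (c + a)) != 1.
    by rewrite lt_eqF// -expR0 ltr_expR nmulr_rlt0.
  rewrite /= big_seq1.
  have -> : exp_decsum x [:: c + a] =
      fun N => geom_ratio x (c + a) * (1 - expR (x * (c + a)) ^+ N).
    apply/funext => N; elim: N => [|N].
      by rewrite /exp_decsum /= big_ord0 expr0 subrr mulr0.
    rewrite /exp_decsum /= big_ord_recr /= => ->.
    rewrite /geom_ratio exprS; field.
    by rewrite subr_eq0 eq_sym.
  have := cvgM (cvg_cst (geom_ratio x (c + a))) (cvgB (cvg_cst (1 : R)) (cvg_expR_pow x0 A0)).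
  rewrite subr0 mulr1; exact.
have A0 : 0 < c + a by rewrite ltr_wpDl.
have e1 : expR (x * (c + a)) != 1.
  by rewrite lt_eqF// -expR0 ltr_expR nmulr_rlt0.
have -> : exp_decsum x [:: c + a, b & s] = fun N => geom_ratio x (c + a) *
    (exp_decsum x (c + a + b :: s) N
     - expR (x * (c + a)) ^+ N * exp_decsum x (0 + b :: s) N).
  by apply/funext => N; rewrite exp_decsum_cons2// add0r.
have -> : scanl +%R c [:: a, b & s] = (c + a) :: scanl +%R (c + a) (b :: s) by [].
rewrite big_cons.
have := cvgM (cvg_cst (geom_ratio x (c + a)))
  (cvgB (IH _ _ (ltW A0) s0) (cvgM (cvg_expR_pow x0 A0) (IH 0 b (lexx 0) s0))).
rewrite mul0r subr0; exact.
Qed.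

(** [scanl] leaves out its start value, so [A] runs over the sums of the nonempty prefixes, one per
    entry of [s]. *)
Lemma cvg_exp_decsum (x : R) (s : seq R) : x < 0 -> all (> 0) s ->
  (exp_decsum x s @ \oo --> \prod_(A <- scanl +%R 0 s) geom_ratio x A)%classic.
Proof.
move=> x0; case: s => [_|a s s0]; first by rewrite big_nil; exact: cvg_cst.
by have := @cvg_exp_decsum_cons x 0 a s x0 (lexx 0) s0; rewrite add0r.
Qed.

End QSums.

(* Expanding each factor [(1 - q^m)^k] by the binomial theorem turns the
   summand of a word into a rational combination of products of the
   [q^(m (k t + i))]; such a product is encoded by the list of its [(k, i)]. *)
Fixpoint expand (w : seq nat) : seq (rat * seq (nat * nat)) :=
  if w is k :: w' then
    [seq ((-1) ^+ i *+ 'C(k, i) * p.1, (k, i) :: p.2)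
       | i <- iota 0 k.+1, p <- expand w']
  else [:: (1, [::])].

Definition exponents (K : pzSemiRingType) (t : K) (l : seq (nat * nat)) : seq K :=
  [seq e.1%:R * t + e.2%:R | e <- l].

Section QSumsWord.
Variable R : realType.

Lemma cvg_sum_seq (I : eqType) (r : seq I) (F : I -> nat -> R) (l : I -> R) :
  (forall i, i \in r -> (F i @ \oo --> l i)%classic) ->
  ((fun n => \sum_(i <- r) F i n) @ \oo --> \sum_(i <- r) l i)%classic.
Proof.
elim: r => [_|i r IH H].
  by rewrite big_nil; under eq_fun do rewrite big_nil; exact: cvg_cst.
rewrite big_cons; under eq_fun do rewrite big_cons.
apply: cvgD; first by apply: H; rewrite mem_head.
by apply: IH => j jr; apply: H; rewrite inE jr orbT.
Qed.

Definition qfactor (x t : R) (k m : nat) : R :=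
  expR (x * (k%:R * t)) ^+ m * (1 - expR x ^+ m) ^+ k.

Lemma qfactorE x t k m : qfactor x t k m =
  \sum_(0 <= i < k.+1) ratr ((-1) ^+ i *+ 'C(k, i)) * expR (x * (k%:R * t + i%:R)) ^+ m.
Proof.
rewrite big_mkord /qfactor exprBn mulr_sumr; apply: eq_bigr => i _.
rewrite expr1n mulr1 rmorphMn rmorphXn rmorphN1 mulrDr expRD.
rewrite exprMn [x * i%:R]mulrC expRM_natl -!exprM [(i * m)%N]mulnC.
by rewrite -mulr_natr -[_ *+ 'C(k, i) in RHS]mulr_natr; ring.
Qed.

Lemma decsum_qfactor x t (w : seq nat) N :
  decsum [seq qfactor x t k | k <- w] N =
  \sum_(p <- expand w) ratr p.1 * exp_decsum x (exponents t p.2) N.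
Proof.
elim: w N => [|k w IH] N; first by rewrite big_seq1 rmorph1 mul1r.
rewrite [expand _]/(allpairs_dep _ _ _) big_allpairs_dep [LHS]/=.
under eq_bigr => m _ do rewrite qfactorE IH mulr_suml.
rewrite exchange_big /=; apply: eq_bigr => i _.
under eq_bigr => m _ do rewrite mulr_sumr.
rewrite exchange_big /=; apply: eq_bigr => p _.
rewrite /exp_decsum /= mulr_sumr; apply: eq_bigr => m _.
by rewrite rmorphM /=; ring.
Qed.

Lemma mem_expand_fst (w : seq nat) p : p \in expand w -> [seq e.1 | e <- p.2] = w.
Proof.
elim: w p => [|k w IH] p; first by rewrite inE => /eqP ->.
by move=> /allpairsPdep[i [p' [_ /IH <- ->]]].
Qed.

Lemma exponents_gt0 (t : R) (w : seq nat) p : 0 < t -> all (fun k => 0 < k)%N w ->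
  p \in expand w -> all (> 0) (exponents t p.2).
Proof.
move=> t0 w0 /mem_expand_fst ew; rewrite -ew all_map in w0.
rewrite all_map; apply: sub_all w0 => e /= e0.
by rewrite ltr_wpDr// mulr_gt0// ltr0n.
Qed.

(** The closed form of the q-zeta value at [q = e^x]; see [qzetaE]. *)
Definition word_sum (t : R) (w : seq nat) (x : R) : R :=
  \sum_(p <- expand w) ratr p.1 *
     \prod_(A <- scanl +%R 0 (exponents t p.2)) geom_ratio x A.

Lemma cvg_decsum_qfactor x t w : x < 0 -> 0 < t -> all (fun k => 0 < k)%N w ->
  (decsum [seq qfactor x t k | k <- w] @ \oo --> word_sum t w x)%classic.
Proof.
move=> x0 t0 w0.
have -> : decsum [seq qfactor x t k | k <- w] = fun N =>
    \sum_(p <- expand w) ratr p.1 * exp_decsum x (exponents t p.2) N.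
  by apply/funext => N; rewrite decsum_qfactor.
apply: cvg_sum_seq => p pw.
apply: cvgM; first exact: cvg_cst.
by apply: cvg_exp_decsum => //; exact: exponents_gt0 pw.
Qed.

End QSumsWord.

(** * Taylor coefficients of the sum attached to a word *)

(* The Taylor coefficients of the product over [A] in [s] of
   [x e^(A x) / (1 - e^(A x))]. *)
Definition prod_coef (K : fieldType) (s : seq K) : nat -> K :=
  foldr (fun A => conv (fun n => ratr (bern n) * A ^+ n / A))
        (fun n => if n == 0%N then 1 else 0) s.

(** One factor [x] per letter clears the simple poles: these are the coefficients of
    [x ^+ size w * word_sum t w x]. *)
Definition word_coef (K : fieldType) (t : K) (w : seq nat) (n : nat) : K :=
  \sum_(p <- expand w) ratr p.1 * prod_coef (scanl +%R 0 (exponents t p.2)) n.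

Lemma scanl_add_gt0 (K : numDomainType) (c : K) (s : seq K) : 0 <= c ->
  all (> 0) s -> all (> 0) (scanl +%R c s).
Proof.
elim: s c => //= a s IH c c0 /andP[a0 s0].
by rewrite ltr_wpDl//= IH// addr_ge0// ltW.
Qed.

Section WordExpansion.
Variable R : realType.

Lemma taylor_prod_coef (s : seq R) : all (> 0) s ->
  taylor (fun x => \prod_(A <- s) (x * geom_ratio x A)) (prod_coef s).
Proof.
elim: s => [_|A s IH /andP[A0 s0]].
  by apply: taylor_eq (taylor_cst 1) => [x _|//]; rewrite big_nil.
have tA : taylor (fun x => x * geom_ratio x A) (fun n => ratr (bern n) * A ^+ n / A).
  have := taylorZ A^-1 (taylor_scale A0 (taylor_bern R)).
  apply: taylor_eq => [x x0|n]; last by rewrite mulrC.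
  by rewrite /geom_ratio [x * A]mulrC -!mulrA mulKf ?gt_eqF.
by apply: taylor_eq (taylorM tA (IH s0)) => [x _|//]; rewrite big_cons.
Qed.

Lemma taylor_word_sum (t : R) (w : seq nat) : 0 < t ->
  all (fun k => 0 < k)%N w ->
  taylor (fun x => x ^+ size w * word_sum t w x) (word_coef t w).
Proof.
move=> t0 w0.
have H p : p \in expand w -> taylor
    (fun x => ratr p.1 * \prod_(A <- scanl +%R 0 (exponents t p.2)) (x * geom_ratio x A))
    (fun n => ratr p.1 * prod_coef (scanl +%R 0 (exponents t p.2)) n).
  move=> pw; apply/taylorZ/taylor_prod_coef/scanl_add_gt0 => //.
  exact: exponents_gt0 pw.
apply: taylor_eq (taylor_sum H) => // x _.
rewrite /word_sum mulr_sumr; apply: eq_big_seq => p pw.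
rewrite mulrCA; congr (_ * _); rewrite big_split /= big_const_seq count_predT.
rewrite iter_mulr_1 size_scanl size_map.
by rewrite -(mem_expand_fst pw) size_map.
Qed.

End WordExpansion.

(** * Subrings containing the Taylor coefficients *)

Definition is_subring (K : pzRingType) (S : K -> Prop) : Prop :=
  [/\ S 1, forall x y, S x -> S y -> S (x - y) & forall x y, S x -> S y -> S (x * y)].

Section Subring.
Variables (K : pzRingType) (S : K -> Prop) (subS : is_subring S).

Lemma subring0 : S 0.
Proof. by case: subS => S1 SB _; rewrite -(subrr 1); exact: SB. Qed.

Lemma subringB x y : S x -> S y -> S (x - y).
Proof. by case: subS => _ SB _; exact: SB. Qed.

Lemma subringM x y : S x -> S y -> S (x * y).
Proof. by case: subS => _ _ SM; exact: SM. Qed.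

Lemma subringN x : S x -> S (- x).
Proof. by move=> Sx; rewrite -sub0r; apply: subringB => //; exact: subring0. Qed.

Lemma subringD x y : S x -> S y -> S (x + y).
Proof. by move=> Sx Sy; rewrite -[y]opprK; apply/subringB/subringN. Qed.

Lemma subring_sum (I : Type) (r : seq I) (P : pred I) (F : I -> K) :
  (forall i, P i -> S (F i)) -> S (\sum_(i <- r | P i) F i).
Proof. by move=> H; apply: big_ind => //; [exact: subring0|exact: subringD]. Qed.

Lemma subringX x n : S x -> S (x ^+ n).
Proof.
move=> Sx; elim: n => [|n IH]; first by rewrite expr0; case: subS.
by rewrite exprS; exact: subringM.
Qed.

Lemma subring_conv (a b : nat -> K) n :
  (forall i, S (a i)) -> (forall i, S (b i)) -> S (conv a b n).
Proof. by move=> Sa Sb; apply: subring_sum => i _; exact: subringM. Qed.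

End Subring.

Section WordCoefSubring.
Variables (K : fieldType) (S : K -> Prop) (subS : is_subring S).
Hypothesis ratS : forall q : rat, S (ratr q).

Lemma subring_nat n : S n%:R.
Proof.
elim: n => [|n IH]; first exact: subring0 subS.
by rewrite -natr1; apply: (subringD subS) => //; case: subS.
Qed.

Lemma subring_scanl (c : K) (s : seq K) : S c -> (forall A, A \in s -> S A) ->
  forall A, A \in scanl +%R c s -> S A.
Proof.
elim: s c => //= a s IH c Sc Ss A; rewrite inE => /predU1P[->|].
  by apply: (subringD subS) => //; apply: Ss; rewrite mem_head.
apply: IH => [|B Bs]; last by apply: Ss; rewrite inE Bs orbT.
by apply: (subringD subS) => //; apply: Ss; rewrite mem_head.
Qed.

Lemma subring_exponents (t : K) l : S t -> forall A, A \in exponents t l -> S A.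
Proof.
move=> St A /mapP[e _ ->]; apply: (subringD subS); last exact: subring_nat.
by apply: (subringM subS) => //; exact: subring_nat.
Qed.

Lemma subring_prod_coef (s : seq K) n : (forall A, A \in s -> S A) ->
  (forall A, A \in s -> S A^-1) -> S (prod_coef s n).
Proof.
elim: s n => [|A s IH] n Ss SV /=.
  by case: ifP => _; [case: subS|exact: subring0 subS].
apply: (subring_conv subS) => i; last first.
  by apply: IH => B Bs; [apply: Ss|apply: SV]; rewrite inE Bs orbT.
apply: (subringM subS); last by apply: SV; rewrite mem_head.
apply: (subringM subS) => //; apply: (subringX subS).
by apply: Ss; rewrite mem_head.
Qed.

(** Inverses are required only for the partial sums that occur, so this also serves for [regular t],
    which need not contain the inverse of [4 * t + 1]. *)
Lemma subring_word_coef (t : K) (w : seq nat) n : S t ->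
  (forall p, p \in expand w ->
     forall A, A \in scanl +%R 0 (exponents t p.2) -> S A^-1) ->
  S (word_coef t w n).
Proof.
move=> St SV; rewrite /word_coef big_seq; apply: (subring_sum subS) => p pw.
apply: (subringM subS) => //; apply: subring_prod_coef; last exact: SV.
apply: subring_scanl; first exact: subring0 subS.
exact: subring_exponents.
Qed.

End WordCoefSubring.

(** * Sequences of complex numbers and power series *)

Section ComplexSequences.
Variable R : realType.
Local Open Scope complex_scope.

Lemma normc_leReIm (z : R[i]) : `|z| <= (`|complex.Re z| + `|complex.Im z|)%:C.
Proof.
rewrite normc_def lecR -[leRHS]ger0_norm ?addr_ge0// -sqrtr_sqr.
apply: ler_wsqrtr; rewrite sqrrD !real_normK ?num_real// addrAC lerDl.
by rewrite mulrn_wge0// mulr_ge0.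
Qed.

Lemma normc_real (x : R) : `|x%:C| = `|x|%:C.
Proof. by rewrite normc_def /= expr0n addr0 sqrtr_sqr. Qed.

Lemma normc_geIm (z : R[i]) : `|complex.Im z|%:C <= `|z|.
Proof.
by rewrite normc_def lecR -sqrtr_sqr; apply: ler_wsqrtr; rewrite lerDr sqr_ge0.
Qed.

Lemma ReB (z w : R[i]) : complex.Re (z - w) = complex.Re z - complex.Re w.
Proof. by case: z w => [a b] [c d]. Qed.

Lemma ImB (z w : R[i]) : complex.Im (z - w) = complex.Im z - complex.Im w.
Proof. by case: z w => [a b] [c d]. Qed.

Lemma Re_sum (I : Type) (r : seq I) (P : pred I) (F : I -> R[i]) :
  complex.Re (\sum_(i <- r | P i) F i) = \sum_(i <- r | P i) complex.Re (F i).
Proof. by apply: big_morph => // -[a b] [c d]. Qed.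

Lemma Im_sum (I : Type) (r : seq I) (P : pred I) (F : I -> R[i]) :
  complex.Im (\sum_(i <- r | P i) F i) = \sum_(i <- r | P i) complex.Im (F i).
Proof. by apply: big_morph => // -[a b] [c d]. Qed.

Lemma Re_mulC (z : R[i]) (r : R) : complex.Re (z * r%:C) = complex.Re z * r.
Proof. by case: z => [a b]; simpc. Qed.

Lemma Im_mulC (z : R[i]) (r : R) : complex.Im (z * r%:C) = complex.Im z * r.
Proof. by case: z => [a b]; simpc. Qed.

Lemma cvg_complex (u : nat -> R[i]) (a b : R) :
  ((fun n => complex.Re (u n)) @ \oo --> a)%classic ->
  ((fun n => complex.Im (u n)) @ \oo --> b)%classic ->
  ((u : nat -> R[i]^o) @ \oo --> ((a +i* b) : R[i]^o))%classic.
Proof.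
move=> /cvgrPdist_lt ua /cvgrPdist_lt ub.
apply/cvgrPdist_lt => e; rewrite ltcE => /andP[/eqP Ime e0].
have e20 : 0 < complex.Re e / 2 by rewrite divr_gt0.
have -> : e = (complex.Re e)%:C by case: e Ime {e0 e20} => x y /= ->.
near=> n.
rewrite (le_lt_trans (normc_leReIm _))// ltcR ReB ImB /= [ltRHS]splitr ltrD//.
  by near: n; exact: ua.
by near: n; exact: ub.
Unshelve. all: by end_near. Qed.

Lemma cvg_Re (u : nat -> R[i]) (l : R[i]) :
  ((u : nat -> R[i]^o) @ \oo --> (l : R[i]^o))%classic ->
  ((fun n => complex.Re (u n)) @ \oo --> complex.Re l)%classic.
Proof.
move=> /cvgrPdist_lt ul; apply/cvgrPdist_lt => e e0.
have := ul e%:C; rewrite ltcR => /(_ e0); apply: filterS => n /= H.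
by rewrite -ltcR -ReB (le_lt_trans (normc_ge_Re _)).
Qed.

Lemma cvg_Im (u : nat -> R[i]) (l : R[i]) :
  ((u : nat -> R[i]^o) @ \oo --> (l : R[i]^o))%classic ->
  ((fun n => complex.Im (u n)) @ \oo --> complex.Im l)%classic.
Proof.
move=> /cvgrPdist_lt ul; apply/cvgrPdist_lt => e e0.
have := ul e%:C; rewrite ltcR => /(_ e0); apply: filterS => n /= H.
by rewrite -ltcR -ImB (le_lt_trans (normc_geIm _)).
Qed.

Lemma cvg_mulCl (u : nat -> R[i]) (k l : R[i]) :
  ((u : nat -> R[i]^o) @ \oo --> (l : R[i]^o))%classic ->
  (((fun n => k * u n) : nat -> R[i]^o) @ \oo --> (k * l : R[i]^o))%classic.
Proof.
move=> /cvgrPdist_lt ul; apply/cvgrPdist_lt => e e0.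
have k1 : 0 < `|k| + 1 by rewrite ltr_wpDl.
have := ul (e / (`|k| + 1)) (divr_gt0 e0 k1); apply: filterS => n /= H.
rewrite -mulrBr normrM; apply: (@le_lt_trans _ _ ((`|k| + 1) * `|l - u n|)).
  by rewrite ler_wpM2r// lerDl.
by rewrite mulrC -ltr_pdivlMr.
Qed.

Lemma cvg_real_complex (u : nat -> R) (l : R) : (u @ \oo --> l)%classic ->
  (((fun n => (u n)%:C) : nat -> R[i]^o) @ \oo --> (l%:C : R[i]^o))%classic.
Proof. by move=> ul; apply: cvg_complex => //; exact: cvg_cst. Qed.

Lemma is_cvg_geometric_dominated (u : nat -> R) (C r : R) : 0 <= r < 1 ->
  (forall i, `|u i| <= C * r ^+ i) -> cvgn (fun n => \sum_(i < n) u i).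
Proof.
move=> /andP[r0 r1] ub.
have -> : (fun n => \sum_(i < n) u i) = series u.
  by apply/funext => n; rewrite /series /= big_mkord.
apply: normed_cvg; apply: (series_le_cvg _ _ ub) => [n|n|]; first exact: normr_ge0.
  exact: le_trans (normr_ge0 _) (ub n).
have -> : (fun i => C * r ^+ i) = geometric C r by [].
by apply: is_cvg_geometric_series; rewrite ger0_norm.
Qed.

(* The smallest nonzero coefficient [c n] would dominate the tail near 0. *)
Lemma power_series_eq0 (c : nat -> R) (delta : R) : 0 < delta ->
  (forall x, - delta < x -> x < 0 ->
     ((fun n => \sum_(i < n) c i * x ^+ i) @ \oo --> (0 : R))%classic) ->
  forall n, c n = 0.
Proof.
move=> d0 H.
pose x0 := - (delta / 2).
have x0d : - delta < x0 by rewrite ltrN2 ltr_pdivrMr// ltr_pMr// ltr1n.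
have x00 : x0 < 0 by rewrite oppr_lt0 divr_gt0.
(* Convergence at the single point [x0] bounds all terms there, hence [c i] by [K / r ^+ i]. *)
have [K [K0 HK]] : exists K, 0 < K /\ forall i, `|c i * x0 ^+ i| <= K.
  have /cvg_seq_bounded[B [Br HB]] : cvgn (fun n => \sum_(i < n) c i * x0 ^+ i).
    by apply/cvg_ex; exists 0; exact: H.
  have HB1 : forall n, `|\sum_(i < n) c i * x0 ^+ i| <= `|B| + 1.
    by move=> n; apply: (HB (`|B| + 1)) => //; rewrite (le_lt_trans (ler_norm B))// ltrDl.
  exists ((`|B| + 1) *+ 2); split=> [|i]; first by rewrite pmulrn_lgt0// ltr_wpDl.
  have -> : c i * x0 ^+ i = \sum_(j < i.+1) c j * x0 ^+ j - \sum_(j < i) c j * x0 ^+ j.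
    by rewrite big_ord_recr /= addrAC subrr add0r.
  by rewrite (le_trans (ler_normB _ _))// mulr2n lerD.
set r := `|x0|.
have r0 : 0 < r by rewrite normr_gt0 lt_eqF.
have cb i : `|c i| <= K / r ^+ i.
  by rewrite ler_pdivlMr ?exprn_gt0// -normrX -normrM.
move=> n; elim/ltn_ind: n => n IH.
apply/eqP; rewrite -normr_le0; apply/ler_addgt0Pl => e e0.
rewrite addr0.
(* It suffices to choose [s] so small that [2 K s / r^(n+1) <= e]. *)
pose s := Num.min (r / 2) (e * r ^+ n.+1 / (K * 2)).
have s0 : 0 < s.
  by rewrite lt_min !divr_gt0//= ?mulr_gt0// exprn_gt0.
have sr : s / r <= 1 / 2.
  by rewrite ler_pdivrMr// mulrC mul1r mulrC ge_min mulrC lexx.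
have se : K * 2 * s / r ^+ n.+1 <= e.
  rewrite ler_pdivrMr ?exprn_gt0// mulrC -ler_pdivlMr ?mulr_gt0//.
  by rewrite ge_min lexx orbT.
have sd : - delta < - s.
  rewrite ltrN2 (@le_lt_trans _ _ r)//; last first.
    by rewrite /r normrN ger0_norm ?divr_ge0 ?ltW// ltr_pdivrMr// ltr_pMr// ltr1n.
  by rewrite ge_min ler_pdivrMr// ler_pMr// ler1n.
have := H (- s) sd; rewrite oppr_lt0 => /(_ s0) Hs.
(* The terms below [n] vanish by induction; those above are dominated by a geometric series of ratio
   [s / r], at most 1/2, hence of sum at most 2. *)
have bound N : `|\sum_(i < n.+1 + N) c i * (- s) ^+ i - c n * (- s) ^+ n|
    <= K * (s / r) ^+ n.+1 * 2.
  rewrite big_split_ord big_ord_recr /= big1 ?add0r => [|i _]; last first.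
    by rewrite IH ?mul0r.
  rewrite addrAC subrr add0r (le_trans (ler_norm_sum _ _ _))//.
  have Hg m : \sum_(i < m) (s / r) ^+ i <= 2.
    suff : \sum_(i < m) (s / r) ^+ i <= 2 - (1 / 2) ^+ m *+ 2.
      by move=> /le_trans; apply; rewrite lerBlDr lerDl mulrn_wge0// exprn_ge0.
    elim: m => [|m IHm]; first by rewrite big_ord0 expr0 subrr.
    rewrite big_ord_recr /= (le_trans (lerD IHm (_ : _ <= (1 / 2) ^+ m)))//.
      by rewrite lerXn2r ?nnegrE// divr_ge0 ?ltW.
    by rewrite exprS; lra.
  apply: (@le_trans _ _ (\sum_(i < N) K * (s / r) ^+ n.+1 * (s / r) ^+ i)).
    apply: ler_sum => i _; rewrite -mulrA -exprD normrM normrX normrN.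
    rewrite (gtr0_norm s0) exprMn exprVn [s ^+ _ / _]mulrC mulrA.
    by rewrite ler_wpM2r ?cb// exprn_ge0// ltW.
  rewrite -mulr_sumr ler_wpM2l// mulr_ge0 ?ltW// exprn_gt0// divr_gt0//.
have lim_bound : `|c n * (- s) ^+ n| <= K * (s / r) ^+ n.+1 * 2.
  have Hc : ((fun N => `|\sum_(i < n.+1 + N) c i * (- s) ^+ i - c n * (- s) ^+ n|)
      @ \oo --> `|0 - c n * (- s) ^+ n|)%classic.
    apply: cvg_norm; apply: cvgB; last exact: cvg_cst.
    have := Hs; rewrite -(cvg_shiftn n.+1).
    by under eq_fun do rewrite addnC.
  rewrite sub0r normrN in Hc; rewrite -(cvg_lim _ Hc)//.
  by apply: limr_le; [exact: cvgP Hc|exact: nearW].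
apply: le_trans se; rewrite -(@ler_pM2r _ (s ^+ n)) ?exprn_gt0//.
move: lim_bound; rewrite normrM normrX normrN (gtr0_norm s0) => /le_trans; apply.
by rewrite expr_div_n [s ^+ n.+1]exprS le_eqVlt; apply/orP; left; apply/eqP; ring.
Qed.

End ComplexSequences.

(** * Laurent expansions *)

Section LaurentExpansion.
Variable R : realType.
Local Open Scope complex_scope.

(* The Laurent series [sum_i c_i z^(i - n)]. *)
Definition laurent_of (n : nat) (c : nat -> R) : laurent R :=
  fun i => if 0 <= i + n%:Z then (c `|(i + n%:Z)%R|%N)%:C else 0.

Lemma laurent_of_psum n c (z : R[i]) M : z != 0 ->
  \sum_(i < M) laurent_of n c (i%:Z - n%:Z) * z ^ (i%:Z - n%:Z) =
  z ^ (- n%:Z) * \sum_(i < M) (c i)%:C * z ^+ i.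
Proof.
move=> z0; rewrite mulr_sumr; apply: eq_bigr => i _.
by rewrite /laurent_of subrK /= expfzDr// mulrA mulrC.
Qed.

(** The real and imaginary parts of [z ^+ i] are bounded by its norm, so both parts of the series
    are dominated by a convergent geometric series. *)
Lemma cvg_power_series_complex (c : nat -> R) (C rho : R) (z : R[i]) :
  0 < rho -> (forall i, `|c i| <= C * rho ^+ i) -> `|z| < rho^-1%:C ->
  cvgn ((fun M => \sum_(i < M) (c i)%:C * z ^+ i) : nat -> R[i]^o).
Proof.
move=> rho0 cb zr.
pose r := complex.Re `|z|.
have rE : `|z| = r%:C by rewrite /r normc_def.
have r0 : 0 <= r by rewrite -lecR -rE; exact: normr_ge0.
have r1 : 0 <= rho * r < 1.
  apply/andP; split; first by rewrite mulr_ge0// ltW.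
  move: zr; rewrite rE ltcR.
  by rewrite -[rho^-1]mul1r ltr_pdivlMr// mulrC.
have zi i : `|z ^+ i| = (r ^+ i)%:C by rewrite normrX rE rmorphXn.
have bound (y : R) i : `|y|%:C <= `|z ^+ i| -> `|y * c i| <= C * (rho * r) ^+ i.
  rewrite zi lecR => yr; rewrite normrM exprMn mulrA mulrC.
  by apply: ler_pM.
have cR : cvgn (fun M => \sum_(i < M) complex.Re (z ^+ i) * c i).
  apply: (@is_cvg_geometric_dominated _ (fun i => complex.Re (z ^+ i) * c i) C _ r1) => i.
  exact/bound/normc_ge_Re.
have cI : cvgn (fun M => \sum_(i < M) complex.Im (z ^+ i) * c i).
  apply: (@is_cvg_geometric_dominated _ (fun i => complex.Im (z ^+ i) * c i) C _ r1) => i.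
  exact/bound/normc_geIm.
have /cvg_ex[a Ha] := cR; have /cvg_ex[b Hb] := cI.
apply/cvg_ex; exists (a +i* b); apply: cvg_complex.
  under eq_fun do rewrite Re_sum.
  by under eq_fun do under eq_bigr do rewrite mulrC Re_mulC.
under eq_fun do rewrite Im_sum.
by under eq_fun do under eq_bigr do rewrite mulrC Im_mulC.
Qed.

(** As the constants of [taylor] serve all orders, the coefficients are at most [2 * M * rho ^+ i].
    The power series thus converges on a complex disc and, times [z ^ (- n)], provides the
    extension; on negative reals the error tends to 0, which identifies it with [f]. *)
Lemma is_laurent_expansion_of (f : R -> R[i]) (g : R -> R) n c :
  (forall x, x < 0 -> f x = (g x)%:C) ->
  taylor (fun x => x ^+ n * g x) c -> is_laurent_expansion f (laurent_of n c).
Proof.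
move=> fg [M [rho [M0 rho1 H]]].
have rho0 : 0 < rho by apply: lt_le_trans rho1.
have cb i : `|c i| <= 2 * M * rho ^+ i.
  (* The endpoint [- rho^-1] of the allowed range turns the bound on the term into one on the
     coefficient. *)
  have xlt : - rho^-1 < 0 by rewrite oppr_lt0 invr_gt0.
  have xE : rho * `|- rho^-1| = 1.
    by rewrite normrN gtr0_norm ?invr_gt0// divff// gt_eqF.
  have := @taylor_coef_bound _ _ _ _ _ M0 H (ltW rho0) (- rho^-1) i xlt.
  rewrite xE => /(_ (lexx _)); rewrite expr1n mulr1 normrM normrX normrN.
  by rewrite normfV (gtr0_norm rho0) exprVn ler_pdivrMr// exprn_gt0.
pose P (z : R[i]) (m : nat) : R[i]^o := z ^ (- n%:Z) * \sum_(i < m) (c i)%:C * z ^+ i.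
exists n, rho^-1, (fun z => lim (P z @ \oo)%classic); split.
- by rewrite invr_gt0.
- by move=> i iN; rewrite /laurent_of leNgt -ltrBrDr sub0r iN.
- move=> z z0 zr; under eq_fun do rewrite (laurent_of_psum _ _ _ z0).
  have /cvg_ex[l Hl] := cvg_power_series_complex rho0 cb zr.
  have cP : cvgn (P z) by apply/cvg_ex; exists (z ^ (- n%:Z) * l); exact: cvg_mulCl.
  exact: cP.
- move=> x xd x0.
  have xr : 0 <= rho * `|x| < 1.
    apply/andP; split; first by rewrite mulr_ge0// ltW.
    by rewrite ltr0_norm// -ltr_pdivlMl// mulr1 ltrNl.
  have cx : ((fun m => \sum_(i < m) c i * x ^+ i) @ \oo --> x ^+ n * g x)%classic.
    apply/cvgrPdist_le => e e0.
    have /cvgrPdist_le/(_ e e0) : ((fun m => M * (rho * `|x|) ^+ m) @ \oo --> (0 : R))%classic.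
      rewrite -(mulr0 M); apply: cvgMl_tmp; apply: cvg_expr.
      by case/andP: xr => ? ?; rewrite ger0_norm.
    apply: filterS => m; rewrite sub0r normrN => he.
    apply: le_trans he; apply: le_trans (ler_norm _).
    by apply: H => //; case/andP: xr => _ /ltW.
  have x0' : x%:C != 0 by rewrite (fmorph_eq0 (real_complex R)) lt_eqF.
  suff H' : (P x%:C @ \oo --> (f x : R[i]^o))%classic.
    exact: (cvg_lim (@norm_hausdorff _ R[i]^o) H').
  have -> : f x = x%:C ^ (- n%:Z) * (x ^+ n * g x)%:C.
    rewrite fg// rmorphM rmorphXn -exprnN mulrA mulVf ?mul1r//.
    by rewrite expf_neq0.
  apply: cvg_mulCl; have := cvg_real_complex cx.
  by under eq_fun do (rewrite rmorph_sum; under eq_bigr do rewrite rmorphM rmorphXn).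
Qed.

(* Multiplying by [x ^ L], with a common [L], puts two expansions of the same
   function in the form of power series in the same indices. *)
Lemma is_laurent_expansion_shift (f : R -> R[i]) a : is_laurent_expansion f a ->
  exists (N : nat) (delta : R), [/\ 0 < delta, forall n : int, n < - N%:Z -> a n = 0 &
    forall L x, (N <= L)%N -> - delta < x -> x < 0 ->
      (((fun M => \sum_(i < M) a (i%:Z - L%:Z) * x%:C ^+ i) : nat -> R[i]^o) @ \oo
         --> (x%:C ^+ L * f x : R[i]^o))%classic].
Proof.
case=> N [delta [F [d0 aN aF Ff]]]; exists N, delta; split=> // L x NL xd x0.
have x0' : x%:C != 0 by rewrite (fmorph_eq0 (real_complex R)) lt_eqF.
have := aF x%:C x0'; rewrite normc_real ltcR ltr0_norm// ltrNl => /(_ xd).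
rewrite (Ff x xd x0) => cu.
have H := @cvg_mulCl _ _ (x%:C ^+ L) _ cu.
rewrite -(cvg_shiftn (L - N)); apply: cvg_trans H; apply: near_eq_cvg.
apply: nearW => M /=; rewrite addnC big_split_ord /= [X in _ = X + _]big1 ?add0r => [|i _]; last first.
  by rewrite aN ?mul0r// ltrBlDr; have := ltn_ord i; lia.
rewrite mulr_sumr; apply: eq_bigr => i _.
have -> : (L - N + i)%N%:Z - L%:Z = i%:Z - N%:Z by lia.
rewrite mulrCA; congr (_ * _).
rewrite (exprnP _ L) (exprnP _ (L - N + i)) -expfzDr//; congr (_ ^ _); lia.
Qed.

Lemma is_laurent_expansion_unique (f : R -> R[i]) a b :
  is_laurent_expansion f a -> is_laurent_expansion f b -> a = b.
Proof.
move=> /is_laurent_expansion_shift[N [d [d0 aN Ha]]].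
move=> /is_laurent_expansion_shift[N' [d' [d'0 bN Hb]]].
pose L := (N + N')%N; pose D := Num.min d d'.
have D0 : 0 < D by rewrite lt_min d0.
have Hab x : - D < x -> x < 0 ->
    (((fun M => \sum_(i < M) (a (i%:Z - L%:Z) - b (i%:Z - L%:Z)) * (x ^+ i)%:C)
     : nat -> R[i]^o) @ \oo --> (0 : R[i]^o))%classic.
  rewrite ltrNl lt_min => /andP[xd xd'] x0.
  have := Ha L x (leq_addr _ _); rewrite ltrNl => /(_ xd x0) ca.
  have := Hb L x (leq_addl _ _); rewrite ltrNl => /(_ xd' x0) cb.
  pose u M : R[i]^o := \sum_(i < M) a (i%:Z - L%:Z) * x%:C ^+ i.
  pose v M : R[i]^o := \sum_(i < M) b (i%:Z - L%:Z) * x%:C ^+ i.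
  have -> : (fun M => \sum_(i < M) (a (i%:Z - L%:Z) - b (i%:Z - L%:Z)) * (x ^+ i)%:C)
      = fun M => u M - v M.
    apply/funext => M; rewrite /u /v -sumrB; apply: eq_bigr => i _.
    by rewrite rmorphXn mulrBl.
  rewrite -[X in (_ --> X)%classic](subrr (x%:C ^+ L * f x)).
  exact: (@cvgB _ R[i]^o _ _ _ u v _ _ ca cb).
have eqL i : a (i%:Z - L%:Z) = b (i%:Z - L%:Z).
  apply/eqP; rewrite -subr_eq0 eq_complex ReB ImB; apply/andP; split; apply/eqP.
    apply: (@power_series_eq0 _
      (fun i : nat => complex.Re (a (i%:Z - L%:Z)) - complex.Re (b (i%:Z - L%:Z))) _ D0) => x xD x0.
    have := cvg_Re (Hab x xD x0).
    under eq_fun do rewrite Re_sum.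
    by under eq_fun do under eq_bigr do rewrite Re_mulC ReB.
  apply: (@power_series_eq0 _
    (fun i : nat => complex.Im (a (i%:Z - L%:Z)) - complex.Im (b (i%:Z - L%:Z))) _ D0) => x xD x0.
  have := cvg_Im (Hab x xD x0).
  under eq_fun do rewrite Im_sum.
  by under eq_fun do under eq_bigr do rewrite Im_mulC ImB.
apply/funext => n; have [nL|Ln] := ltP n (- L%:Z).
  by rewrite aN ?bN// (lt_le_trans nL)// lerN2 lez_nat ?leq_addl ?leq_addr.
have -> : n = (`|(n + L%:Z)%R|%N)%:Z - L%:Z by lia.
exact: eqL.
Qed.

Lemma laurent_expansionE (f : R -> R[i]) a :
  is_laurent_expansion f a -> laurent_expansion f = a.
Proof.
move=> fa; apply: xget_unique => // b fb.
exact: is_laurent_expansion_unique fb fa.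
Qed.

Lemma cexp_real (r : R) : cexp r%:C = (expR r)%:C.
Proof. by rewrite /cexp /= cos0 sin0 mulr1. Qed.

Lemma qzeta_partialE (t x : R) (w : word) N :
  qzeta_partial t%:C (expR x) w N =
  (decsum [seq qfactor x t k | k <- map absz w] N)%:C.
Proof.
rewrite -[RHS]/(real_complex R _) decsum_rmorph -!map_comp /=.
rewrite -(decsum_tuple (n := size w)) ?size_map//.
apply: eq_bigr => m _; apply: eq_bigr => j _.
rewrite (nth_map 0)//= /qfactor rmorphM; congr (_ * _); last first.
  by rewrite [RHS]rmorphXn rmorphB rmorph1.
have -> : qpow (expR x) (`|w`_j|%:R * (tnth m j)%:R * t%:C) =
    cexp (x * (`|w`_j|%:R * t) *+ tnth m j)%:C.
  rewrite /qpow expRK; congr cexp.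
  by rewrite rmorphMn !rmorphM rmorph_nat -mulr_natr; ring.
by rewrite cexp_real -mulr_natl expRM_natl.
Qed.

Lemma qzetaE (t x : R) (w : word) : x < 0 -> 0 < t -> is_word w ->
  qzeta t%:C (expR x) w = (word_sum t (map absz w) x)%:C.
Proof.
move=> x0 t0 ww.
suff H : ((qzeta_partial t%:C (expR x) w : nat -> R[i]^o) @ \oo -->
    ((word_sum t (map absz w) x)%:C : R[i]^o))%classic.
  exact: (cvg_lim (@norm_hausdorff _ R[i]^o) H).
have -> : qzeta_partial t%:C (expR x) w =
    fun N => (decsum [seq qfactor x t k | k <- map absz w] N)%:C.
  by apply/funext => N; rewrite qzeta_partialE.
apply/cvg_real_complex/cvg_decsum_qfactor => //.
by rewrite all_map; apply: sub_all ww => k /= k0; rewrite absz_gt0 lt_eqF.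
Qed.

Lemma psiE (t : R) (w : word) i : 0 < t -> is_word w -> w != [::] ->
  psi t%:C w i = (-1) ^+ weight w *
    laurent_of (size w) (word_coef t (map absz w)) (i + (weight w)%:Z).
Proof.
move=> t0 ww w0; rewrite /psi; case: w w0 ww => // k w _ ww; congr (_ * _).
rewrite (@laurent_expansionE _ (laurent_of (size (k :: w)) (word_coef t (map absz (k :: w)))))//.
apply: (@is_laurent_expansion_of _ (word_sum t (map absz (k :: w)))).
  by move=> x x0; exact: qzetaE.
rewrite -(size_map absz); apply: taylor_word_sum => //.
by rewrite all_map; apply: sub_all ww => j /= j0; rewrite absz_gt0 lt_eqF.
Qed.

End LaurentExpansion.

(** * Renormalised values *)

Section Renormalisation.
Variable R : realType.
Local Open Scope complex_scope.

Lemma is_subring_complex (S : R -> Prop) : is_subring S ->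
  is_subring (fun z : R[i] => exists2 x, S x & z = x%:C).
Proof.
move=> subS; split=> [|_ _ [x Sx ->] [y Sy ->]|_ _ [x Sx ->] [y Sy ->]].
- by exists 1 => //; case: subS.
- by exists (x - y); [exact: subringB|rewrite rmorphB].
- by exists (x * y); [exact: subringM|rewrite rmorphM].
Qed.

Lemma is_word_take (w : word) j : is_word w -> is_word (take j w).
Proof. by rewrite -{1}(cat_take_drop j w) /is_word all_cat => /andP[]. Qed.

Lemma is_word_drop (w : word) j : is_word w -> is_word (drop j w).
Proof. by rewrite -{1}(cat_take_drop j w) /is_word all_cat => /andP[]. Qed.

Lemma subring_bogoliubov (S : R[i] -> Prop) (t : R[i]) (w : word) n :
  is_subring S ->
  (forall v i, is_word v -> v != [::] -> S (psi t v i)) ->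
  is_word w -> w != [::] -> S (bogoliubov t w n).
Proof.
move=> subS Spsi ww w0.
suff Sminus v i : is_word v -> (size v < size w)%N -> S (psi_minus t v i).
  apply: (subringD subS); first exact: Spsi.
  rewrite big_nat; apply: (subring_sum subS) => j /andP[j0 jw].
  (* [lmul] is by definition a sum over a finite list, so its support need not be determined. *)
  apply: (subring_sum subS) => i _; apply: (subringM subS).
    by apply: Sminus; [exact: is_word_take|rewrite size_take jw].
  by apply: Spsi; [exact: is_word_drop|rewrite -size_eq0 size_drop subn_eq0 -ltnNge].
have [k] := ubnP (size v); elim: k v i => // k IH v i vk wv vw.
have [->|v0] := eqVneq v [::].
  by rewrite psi_minus_nil /lone; case: eqP => _; [case: subS|exact: subring0 subS].
rewrite psi_minusE//; apply: (subringN subS); rewrite /lproj.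
case: ifP => _; last exact: subring0 subS.
apply: (subringD subS); first exact: Spsi.
rewrite big_nat; apply: (subring_sum subS) => j /andP[j0 jv].
apply: (subring_sum subS) => l _; apply: (subringM subS).
  apply: IH; [by rewrite size_take jv (leq_trans jv)|exact: is_word_take|].
  by rewrite size_take jv (ltn_trans jv).
by apply: Spsi; [exact: is_word_drop|rewrite -size_eq0 size_drop subn_eq0 -ltnNge].
Qed.

(** Minimal subtraction removes negative powers only and leaves the constant term alone. *)
Lemma zeta_plus_bogoliubov (t : R[i]) (w : word) : w != [::] ->
  zeta_plus t w = bogoliubov t w 0.
Proof. by case: w => // k w _; rewrite /zeta_plus /psi_plus /lproj ltxx subr0. Qed.

Lemma subring_psi (S : R -> Prop) (t : R) (w : word) i : is_subring S -> 0 < t ->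
  is_word w -> w != [::] -> (forall n, S (word_coef t (map absz w) n)) ->
  exists2 x, S x & psi t%:C w i = x%:C.
Proof.
move=> subS t0 ww w0 Sw; have subSC := is_subring_complex subS.
rewrite psiE//; apply: (subringM subSC).
  by apply: (subringX subSC); apply: (subringN subSC); case: subSC.
rewrite /laurent_of; case: ifP => _; last exact: subring0 subSC.
by exists (word_coef t (map absz w) `|(i + weight w + size w)%R|%N).
Qed.

Lemma subring_zeta_plus (S : R -> Prop) (t : R) (w : word) :
  is_subring S -> (forall q : rat, S (ratr q)) ->
  (forall x, S x -> S x^-1) -> S t -> 0 < t -> is_word w -> w != [::] ->
  exists2 x, S x & zeta_plus t%:C w = x%:C.
Proof.
move=> subS ratS SV St t0 ww w0; rewrite zeta_plus_bogoliubov//.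
apply: (subring_bogoliubov _ (is_subring_complex subS)) => // v i wv v0.
apply: subring_psi => // n.
apply: subring_word_coef => // p _ A; move=> Ap; apply: SV.
apply: (subring_scanl subS (subring0 subS) _ Ap) => B.
exact: subring_exponents.
Qed.

(** * Rational numbers, and rational functions regular at -1/4 *)

Lemma is_subring_rat : is_subring (fun x : R => exists q : rat, x = ratr q).
Proof.
split=> [|_ _ [p ->] [q ->]|_ _ [p ->] [q ->]].
- by exists 1; rewrite rmorph1.
- by exists (p - q); rewrite rmorphB.
- by exists (p * q); rewrite rmorphM.
Qed.

Lemma ratr_complex (q : rat) : (ratr q : R)%:C = ratr q :> R[i].
Proof. exact: (fmorph_rat (real_complex R)). Qed.

(* The values at [t] of the rational functions over [rat] without pole at
   [-1/4]; for transcendental [t], [1 / (4 t + 1)] is not such a value. *)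
Definition regular (t x : R) : Prop :=
  exists p q : {poly rat}, [/\ q.[- (1 / 4)] != 0, (map_poly ratr q).[t] != 0 &
    x = (map_poly ratr p).[t] / (map_poly ratr q).[t]].

Lemma is_subring_regular t : is_subring (regular t).
Proof.
split=> [|_ _ [p [q [q4 qt ->]]] [p' [q' [q4' qt' ->]]]|
          _ _ [p [q [q4 qt ->]]] [p' [q' [q4' qt' ->]]]].
- by exists 1, 1; rewrite !rmorph1 !hornerC; split; rewrite ?oner_eq0// divr1.
- exists (p * q' - p' * q), (q * q').
  rewrite rmorphB !rmorphM !hornerE; split; rewrite ?mulf_neq0//.
  by field; rewrite qt qt'.
- exists (p * p'), (q * q').
  rewrite !rmorphM !hornerM; split; rewrite ?mulf_neq0//.
  by rewrite mulf_div.
Qed.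

Lemma regular_rat t q : regular t (ratr q).
Proof.
exists q%:P, 1; rewrite rmorph1 !hornerC oner_eq0; split=> //.
by rewrite map_polyC hornerC divr1.
Qed.

Lemma regular_id t : regular t t.
Proof.
exists 'X, 1; rewrite rmorph1 !hornerC oner_eq0; split=> //.
by rewrite map_polyX hornerX divr1.
Qed.

(** The zero [- i / k] of the denominator differs from [-1/4] exactly when [k != 4 * i]. *)
Lemma regular_inv_affine t (k i : nat) : 0 < t -> (0 < k)%N -> k != (4 * i)%N ->
  regular t (k%:R * t + i%:R)^-1.
Proof.
move=> t0 k0 ki; pose q : {poly rat} := k%:R%:P * 'X + i%:R%:P.
have qt : (map_poly ratr q).[t] = k%:R * t + i%:R.
  by rewrite rmorphD rmorphM /= map_polyX !map_polyC /= !hornerE !rmorph_nat.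
exists 1, q; rewrite qt; split.
- rewrite !hornerE; apply: contra ki => /eqP h; rewrite -(eqr_nat rat) natrM.
  by apply/eqP; move: h; lra.
- by rewrite gt_eqF// ltr_wpDr// mulr_gt0// ltr0n.
- by rewrite rmorph1 hornerC mul1r.
Qed.

(* If [B] vanishes at [t = -1/4], then [B^(6 - i) / B] is still regular for
   [i < 6], so that only the term [i = 6] of the Cauchy product has a pole. *)
Lemma prod_coef2_regular t (A B : R) : regular t A -> regular t A^-1 ->
  regular t B -> B != 0 ->
  regular t (prod_coef [:: A; B] 6 - ratr (bern 0 * bern 6) * (A ^+ 6 / A) / B).
Proof.
move=> rA rAV rB B0; have subr := is_subring_regular t.
have convd (a : nat -> R) n : conv a (fun m => if m == 0%N then 1 else 0) n = a n.
  rewrite /conv big_ord_recr /= subnn mulr1 big1 ?add0r// => i _.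
  by rewrite subn_eq0 leqNgt ltn_ord mulr0.
have -> : prod_coef [:: A; B] 6 = \sum_(i < 7) (ratr (bern i) * A ^+ i / A) *
    (ratr (bern (6 - i)) * B ^+ (6 - i) / B).
  by apply: eq_bigr => i _; rewrite [conv _ _ _]convd.
rewrite big_ord_recr /= subnn expr0 mulr1.
have -> : ratr (bern 6) * A ^+ 6 / A * (ratr (bern 0) / B) =
    ratr (bern 0 * bern 6) * (A ^+ 6 / A) / B by rewrite rmorphM; ring.
rewrite addrK; apply: (subring_sum subr) => i _.
have -> : B ^+ (6 - i) = B ^+ (5 - i) * B by rewrite -exprSr -subSn// -ltnS.
rewrite [_ * (_ * B)]mulrA mulfK//.
have rr q := @regular_rat t q.
by do ?[exact: rr|assumption|apply: (subringM subr)|apply: (subringX subr)].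
Qed.

(** The product of [psi_minus] and [psi] involves one-letter words only, with denominators [k t + j]
    for [k = 1] or [k = 3], which do not vanish at [-1/4]. A pole can come only from [psi] of the
    full word, and the added fraction cancels it. *)
Lemma zeta_plus_13_regular (t : R) (z : R) : 0 < t ->
  zeta_plus t%:C [:: -1; -3] = z%:C ->
  regular t (z + ratr (bern 0 * bern 6) *
    ((3 * t ^+ 5 + (t + 1) ^+ 5) / (4 * t + 1))).
Proof.
move=> t0; have subr := is_subring_regular t.
have subrC := is_subring_complex subr.
have rr q := @regular_rat t q.
have rn := subring_nat subr.
have rt := regular_id t.
have raff k i := @regular_inv_affine t k i t0.
have psi1 (k : nat) i : (0 < k)%N -> (forall j, k != 4 * j)%N ->
    exists2 x, regular t x & psi t%:C [:: - k%:Z] i = x%:C.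
  move=> k0 k4; apply: subring_psi => //; first by rewrite /is_word /= oppr_lt0 ltz_nat k0.
  move=> n; apply: subring_word_coef => // p pw A.
  have := mem_expand_fst pw; rewrite /= abszN absz_nat.
  case: (p.2) => [//|[k' j] [|//]] [->]; rewrite inE => /eqP ->.
  by rewrite add0r; exact: raff.
have -> : zeta_plus t%:C [:: -1; -3] = psi t%:C [:: -1; -3] 0 +
    lmul (psi_minus t%:C [:: -1]) (psi t%:C [:: -3]) 0.
  by rewrite zeta_plus_bogoliubov// /bogoliubov big_nat1.
have [l rl ->] : exists2 l, regular t l &
    lmul (psi_minus t%:C [:: -1]) (psi t%:C [:: -3]) 0 = l%:C.
  apply: (subring_sum subrC) => i _; apply: (subringM subrC); last first.
    by apply: (psi1 3%N) => // -[|j]; rewrite ?mulnS.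
  rewrite psi_minusE//; apply: (subringN subrC); rewrite /lproj.
  case: ifP => _; last exact: subring0 subrC.
  by rewrite /bogoliubov big_geq// addr0; apply: (psi1 1%N) => // -[|j]; rewrite ?mulnS.
(* The index 6 is the weight 4 plus one for each of the two letters. *)
have -> : psi t%:C [:: -1; -3] 0 = (word_coef t [:: 1; 3]%N 6)%:C.
  rewrite psiE//; have -> : weight [:: -1; -3] = 4%N by rewrite /weight !big_cons big_nil.
  by rewrite -signr_odd mul1r.
rewrite -rmorphD => /(@fmorph_inj _ _ (real_complex R) _ _) <-.
rewrite addrAC; apply: (subringD subr) => //.
set c := bern 0 * bern 6; set T := _ / _.
(* Only the pairs of exponents with [B = 4 t + 1] contribute a pole. *)
pose D l : R := if sumn [seq e.2 | e <- l] == 1%N then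
  let s := scanl +%R 0 (exponents t l) in ratr c * (s`_0 ^+ 6 / s`_0) / s`_1 else 0.
have sumD : \sum_(p <- expand [:: 1; 3]%N) ratr p.1 * D p.2 = - (ratr c * T).
  rewrite /expand /= !big_cons big_nil /D /=. 
  rewrite !mulr0 !addr0 !add0r !(bin0, bin1, binn) !(expr0, expr1).
  rewrite !(rmorphM, rmorphMn, rmorphN, rmorph1, mul1r, mulr1) /T.
  have t1 : t + 1 != 0 by rewrite gt_eqF// addr_gt0.
  have t4 : 4 * t + 1 != 0 by rewrite gt_eqF// addr_gt0// mulr_gt0.
  have t14 : t + 3 * t + 1 != 0 by have -> : t + 3 * t + 1 = 4 * t + 1 by ring.
  have t41 : t + 1 + 3 * t != 0 by rewrite addrAC.
  by field; rewrite t4 t1 gt_eqF.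
rewrite -[ratr c * T]opprK -sumD -sumrB big_seq; apply: (subring_sum subr) => p pw.
rewrite -mulrBr; apply: (subringM subr) => //.
have := mem_expand_fst pw; case: (p.2) => [//|[k i] [//|[k' j] [|//]]] [-> ->].
pose A := 0 + (1%:R * t + i%:R); pose B := A + (3%:R * t + j%:R).
have sE : scanl +%R 0 (exponents t [:: (1%N, i); (3%N, j)]) = [:: A; B] by [].
rewrite /D sE [_`_0]/= [_`_1]/= [sumn _]/=.
have AE : A = 1%:R * t + i%:R by rewrite /A add0r.
have BE : B = 4%:R * t + (i + j)%:R by rewrite /B AE natrD; ring.
have rA : regular t A by rewrite AE; apply: (subringD subr) => //; apply: (subringM subr).
have rB : regular t B by rewrite BE; apply: (subringD subr) => //; apply: (subringM subr).
have rAV : regular t A^-1 by rewrite AE; apply: raff => //; case: (i) => [|?]; rewrite ?mulnS.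
(* [B = 4 t + (i + j)] vanishes at [t = -1/4] only for [i + j = 1]; otherwise its inverse is
   regular. *)
rewrite addn0; case: eqP => ij.
  by apply: prod_coef2_regular => //; rewrite BE gt_eqF// ltr_wpDr// mulr_gt0.
rewrite subr0; apply: (subring_prod_coef subr rr) => C; rewrite !inE => /orP[]/eqP-> //.
by rewrite BE; apply: raff => //; apply/eqP => h; apply: ij; lia.
Qed.

Lemma algebraic_real (t : R) (p : {poly rat}) : p != 0 ->
  (map_poly ratr p).[t] = 0 -> algebraicOver (ratr : rat -> R[i]) t%:C.
Proof.
move=> p0 pt; exists p => //; apply/rootP.
have -> : map_poly ratr p = map_poly (real_complex R) (map_poly ratr p).
  by rewrite -map_poly_comp; apply: eq_map_poly => q; rewrite /= ratr_complex.
by rewrite horner_map pt rmorph0.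
Qed.

(** Clearing denominators makes [t] a root of [c N q - p d]. At [-1/4], [d] vanishes while [N] is
    [15 / 64] and [q] is nonzero, so this polynomial is nonzero. *)
Lemma not_regular (t : R) (c : rat) : 0 < t -> c != 0 ->
  ~ algebraicOver (ratr : rat -> R[i]) t%:C ->
  ~ regular t (ratr c * ((3 * t ^+ 5 + (t + 1) ^+ 5) / (4 * t + 1))).
Proof.
move=> t0 c0 talg [p [q [q4 qt e]]]; apply: talg.
pose N : {poly rat} := 'X ^+ 5 *+ 3 + ('X + 1) ^+ 5.
pose d : {poly rat} := 'X *+ 4 + 1.
have Nt : (map_poly ratr N).[t] = 3 * t ^+ 5 + (t + 1) ^+ 5.
  by rewrite /N !(rmorphD, rmorphMn, rmorphXn, rmorph1) /= map_polyX !(hornerE, hornerMn) /=; ring.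
have dt : (map_poly ratr d).[t] = 4 * t + 1.
  by rewrite /d !(rmorphD, rmorphMn, rmorph1) /= map_polyX !(hornerE, hornerMn) /=; ring.
have NE (x : rat) : N.[x] = 3 * x ^+ 5 + (x + 1) ^+ 5.
  by rewrite /N !(hornerE, hornerMn) /=; ring.
have dE (x : rat) : d.[x] = 4 * x + 1 by rewrite /d !(hornerE, hornerMn) /=; ring.
have d0 : 4 * t + 1 != 0 by rewrite gt_eqF// addr_gt0// mulr_gt0.
apply: (@algebraic_real _ (c%:P * N * q - p * d)).
  apply/eqP => /(congr1 (fun P : {poly rat} => P.[- (1 / 4)])).
  have -> : (c%:P * N * q - p * d).[- (1 / 4)] = c * (15 / 64) * q.[- (1 / 4)].
    have e1 : 3 * (- (1 / 4)) ^+ 5 + (- (1 / 4) + 1) ^+ 5 = 15 / 64 :> rat by field.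
    have e2 : 4 * (- (1 / 4)) + 1 = 0 :> rat by field.
    by rewrite hornerD hornerN !hornerM hornerC NE dE e1 e2 mulr0 subr0.
  by rewrite horner0 => /eqP; rewrite !mulf_eq0 (negbTE c0) (negbTE q4).
rewrite rmorphB !rmorphM /= hornerD hornerN !hornerM map_polyC hornerC Nt dt.
have -> : ratr c * (3 * t ^+ 5 + (t + 1) ^+ 5) =
    (map_poly ratr p).[t] / (map_poly ratr q).[t] * (4 * t + 1).
  by rewrite -e; field.
by field.
Qed.

End Renormalisation.

Unset Implicit Arguments.

Theorem corollary4p3 (R : realType) :
  (forall t : R[i], in_D t -> crational t ->
     forall (n : nat) (k : n.-tuple int), (0 < n)%N -> is_word k ->
       crational (zeta_plus t k))
  /\
  (forall t : R[i], in_D t -> t \is Num.real -> transcendental t ->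
     exists (n : nat) (k : n.-tuple int),
       [/\ (0 < n)%N, is_word k, zeta_plus t k \is Num.real
         & ~ crational (zeta_plus t k)]).
Proof.
split=> [t t0 [q tq] n k n0 kw|t t0 /complex_realP[r tr] talg].
  have tE : t = (ratr q)%:C%C by rewrite tq ratr_complex.
  rewrite tE /in_D /= in t0 *.
  have k0 : tval k != [::] by rewrite -size_eq0 size_tuple -lt0n.
  have ratV (x : R) : (exists p : rat, x = ratr p) -> exists p : rat, x^-1 = ratr p.
    by move=> [p ->]; exists p^-1; rewrite fmorphV.
  have [_ [p ->] ->] := subring_zeta_plus (is_subring_rat R)
    (fun p => ex_intro _ p erefl) ratV (ex_intro _ q erefl) t0 kw k0.
  by exists p; rewrite ratr_complex.
rewrite tr /in_D /= in t0 talg *.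
exists 2%N, [tuple -1; -3]; split=> //.
  have [x _ ->] : exists2 x : R, True & zeta_plus r%:C%C [:: -1; -3] = x%:C%C.
    (* With the trivial predicate only the claim that the value is real remains. *)
    exact: (@subring_zeta_plus R (fun=> True)).
  by rewrite complex_real.
case=> q zq.
have := @zeta_plus_13_regular R r (ratr q) t0; rewrite ratr_complex => /(_ zq).
have subr := is_subring_regular r.
(* Subtracting the supposedly rational value would make the polar term itself regular. *)
move=> /(subringB subr)/(_ (regular_rat r q)); rewrite addrAC subrr add0r.
by apply: not_regular => //; rewrite bern0 mulN1r oppr_eq0 bern6_neq0.
Qed.
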